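(* Consider the ongoing market with warehouses described in the context, where the demand functions satisfy fixed spending, WGS and elasticity $E\ge1$ (as defined in the context). Assume that at all times, for all $i$: $|\tilde w_i-w_i|\le\frac13w_i$ and $x_i\le d\,\tilde w_i$, where $d\ge2$. Assume $1<\alpha_2<2$, $\frac{\alpha_2}{2}+\alpha_1\max\{\frac32,d-1\}\le1$, $\lambda E<1$, $\lambda\alpha_1+\frac43\lambda\big(1+\frac{2Ed}{1-\lambda E}+\frac12\alpha_2\big)\le1$, $4\kappa(1+\alpha_2)\le\lambda\alpha_1\le\frac12$, and $\frac{\kappa(\alpha_2-1)}2\le1$. Then for all $t\ge0$, \[ \phi(t+1)\le\Big(1-\frac{\kappa(\alpha_2-1)}{4}\Big)\phi(t). \] Moreover, if $\phi(s)\ge2(1+2\alpha_2)\sum_i|\tilde w_i(s)-w_i|\,p_i(s)$ for all $s\in[t,t+1]$, then $\phi(t+1)\le\big(1-\frac{\lambda\alpha_1}{8(1+\alpha_2)}\big)\phi(t)$.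
   Context: Market: $n$ goods with daily supply rates $w_i>0$, demand functions $x_i:(0,\infty)^n\to(0,\infty)$ (instantaneous daily rates) satisfying (fixed spending) $\sum_ip_ix_i(p)=M$ for all $p$ (constant $M>0$); (WGS) for $j\ne i$, $x_j(p)$ is non-decreasing in $p_i$; (elasticity $E$) $x_i$ differentiable in $p_i$ with $\frac{x_i}{p_i}\le-\frac{\partial x_i}{\partial p_i}\le E\frac{x_i}{p_i}$. Dynamics: continuous time $t\ge0$ (unit one day); $p(t)$ piecewise constant, right-continuous, finitely many changes in bounded intervals; $x_i(t)=x_i(p(t))$. Each good has a warehouse with stock $s_i(t)$, $\frac{ds_i}{dt}=w_i-x_i(t)$, target stock $s_i^*$, and parameter $\kappa>0$; the target demand is $\tilde w_i(t)=w_i+\kappa(s_i(t)-s_i^* )$. Each price changes only at its own update times; $0$ is an update time for all goods and consecutive update times of a good are at most $1$ apart. $\tau_i(t)$ is the last update time of $p_i$ that is $\le t$; $\bar x_i(t)=\frac{1}{t-\tau_i(t)}\int_{\tau_i(t)}^tx_i(s)ds$ (and $\bar x_i=x_i$ when $t=\tau_i(t)$). At an update time $t$ of good $i$: $p_i(t)=p_i(t^-)\big(1+\lambda\,\mathrm{median}\{-1,\frac{\bar x_i(t^-)-\tilde w_i(t)}{w_i},1\}\big)$, with $\lambda>0$. $\mathrm{span}(a,b,c)=\max-\min$ of $a,b,c$. Potential $\phi=\sum_i\phi_i$, $\phi_i=p_i\big[\mathrm{span}(x_i,\bar x_i,\tilde w_i)-\lambda\alpha_1(t-\tau_i)|\bar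 x_i-\tilde w_i|+\alpha_2|\tilde w_i-w_i|\big]$, with constants $\alpha_1,\alpha_2>0$. *)

(* Defs.v *)
From Stdlib Require Import Reals Lra ClassicalEpsilon.
Open Scope R_scope.

(* Goods are indexed by 0..n-1 (i < n); price vectors are functions nat -> R,
   only the coordinates j < n being meaningful. *)

Fixpoint rsum (n : nat) (f : nat -> R) : R :=
  match n with O => 0 | S m => rsum m f + f m end.

Definition upd (q : nat -> R) (i : nat) (r : R) : nat -> R :=
  fun j => if Nat.eqb j i then r else q j.

Definition posvec (n : nat) (q : nat -> R) : Prop :=
  forall j, (j < n)%nat -> 0 < q j.

Definition med3 (a b c : R) : R := Rmax (Rmin a b) (Rmin (Rmax a b) c).
Definition span3 (a b c : R) : R := Rmax a (Rmax b c) - Rmin a (Rmin b c).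

Definition integ (f : R -> R) (a b : R) : R :=
  epsilon (inhabits 0)
    (fun v => exists pr : Riemann_integrable f a b, RiemannInt pr = v).

Definition last_update (u : nat -> R) (t : R) : R :=
  epsilon (inhabits 0) (fun r => exists k, u k <= t < u (S k) /\ r = u k).

Definition market_demand (n : nat) (x : nat -> (nat -> R) -> R) (M E : R) : Prop :=
  (forall i q q', (forall j, (j < n)%nat -> q j = q' j) -> x i q = x i q') /\
  (forall i q, (i < n)%nat -> posvec n q -> 0 < x i q) /\
  (forall q, posvec n q -> rsum n (fun i => q i * x i q) = M) /\
  (forall i j q r r', (i < n)%nat -> (j < n)%nat -> j <> i -> posvec n q ->
      0 < r -> r <= r' -> x j (upd q i r) <= x j (upd q i r')) /\
  (forall i q, (i < n)%nat -> posvec n q ->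
      exists D, derivable_pt_lim (fun r => x i (upd q i r)) (q i) D /\
        x i q / q i <= - D /\ - D <= E * x i q / q i).

(* Update times of each good: u i 0 = 0 < u i 1 < ..., consecutive at most
   1 apart, unbounded (so finitely many in bounded intervals). *)
Definition update_schedule (n : nat) (u : nat -> nat -> R) : Prop :=
  forall i, (i < n)%nat ->
    u i O = 0 /\
    (forall k, u i k < u i (S k) /\ u i (S k) <= u i k + 1) /\
    (forall T, exists k, T < u i k).

Definition pv (p : nat -> R -> R) (t : R) : nat -> R := fun j => p j t.
Definition demand_at (x : nat -> (nat -> R) -> R) (p : nat -> R -> R) (i : nat) (t : R) : R :=
  x i (pv p t).

Definition stock (w : nat -> R) (x : nat -> (nat -> R) -> R) (p : nat -> R -> R)
  (s0 : nat -> R) (i : nat) (t : R) : R :=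
  s0 i + integ (fun r => w i - demand_at x p i r) 0 t.

Definition tw (w : nat -> R) (x : nat -> (nat -> R) -> R) (p : nat -> R -> R)
  (s0 sstar : nat -> R) (kappa : R) (i : nat) (t : R) : R :=
  w i + kappa * (stock w x p s0 i t - sstar i).

Definition tau (u : nat -> nat -> R) (i : nat) (t : R) : R := last_update (u i) t.

Definition xbar (x : nat -> (nat -> R) -> R) (p : nat -> R -> R) (u : nat -> nat -> R)
  (i : nat) (t : R) : R :=
  if Req_dec_T t (tau u i t) then demand_at x p i t
  else integ (fun r => demand_at x p i r) (tau u i t) t / (t - tau u i t).

Definition phi_i (w : nat -> R) (x : nat -> (nat -> R) -> R) (p : nat -> R -> R)
  (u : nat -> nat -> R) (s0 sstar : nat -> R) (kappa lambda alpha1 alpha2 : R)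
  (i : nat) (t : R) : R :=
  let twi := tw w x p s0 sstar kappa i t in
  let xb := xbar x p u i t in
  p i t * (span3 (demand_at x p i t) xb twi
           - lambda * alpha1 * (t - tau u i t) * Rabs (xb - twi)
           + alpha2 * Rabs (twi - w i)).

Definition phi (n : nat) (w : nat -> R) (x : nat -> (nat -> R) -> R) (p : nat -> R -> R)
  (u : nat -> nat -> R) (s0 sstar : nat -> R) (kappa lambda alpha1 alpha2 : R)
  (t : R) : R :=
  rsum n (fun i => phi_i w x p u s0 sstar kappa lambda alpha1 alpha2 i t).

(* Main.v *)
Require Import Defs.
From Stdlib Require Import Reals.
From Stdlib Require Import Lra Lia ClassicalEpsilon.
From Coquelicot Require Import Coquelicot.
Open Scope R_scope.

(** Between updates each term [phi_i] is a maximum of finitely many smooth branches, each with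
    right derivative at most [- kappa * (alpha2 - 1) / 2 * phi_i], and also at most
    [- 3 / 4 * lambda * alpha1 * p_i * span_i].  At an update instant the sum [phi] does not
    increase: perform all price cuts simultaneously, then all price rises.  By gross substitutes
    the demands for the goods whose prices stay put all move in the same direction during a
    phase, so with fixed spending the phase can be checked good by good on [phi_i] plus (cuts)
    or minus (rises) the spending on good [i].  Since the hypothesis [x_i <= d * wt_i] passes to
    left limits, and cuts only lower the demands for the other goods, it is available whenever a
    price is changed. *)

(** * The potential of one good at a price update *)

(** The obstacle is that a single [phi_i] need not decrease at an update: changing one price moves
    the demand for every other good and may widen its span. Spending pays for this exactly. If the
    price of a good is untouched and its demand moves by [delta], its potential grows by at most
    [p_i * |delta|] while its spending changes by [p_i * delta]; so adding spending when demand
    falls, or subtracting it when demand rises, cancels the growth. With cuts and rises mixed the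
    sign of [delta] is unknown, hence the two phases and a price vector between them that need not
    occur in time. Since [phi] has kinks and downward jumps, its decay is read off one-sided slopes
    together with a condition at left limits. Comparison with a straight line instead of an
    exponential halves the rates: [kappa * (alpha2 - 1) / 2] and
    [lambda * alpha1 / (4 * (1 + alpha2))] yield the constants of the theorem. The factor [3 / 4]
    arises because [4 * kappa * (1 + alpha2) <= lambda * alpha1] lets the drift of the target demand
    consume at most a quarter of the rate [lambda * alpha1]. *)

Lemma span3_bounds (a b c : R) :
  0 <= span3 a b c /\
  (a - b <= span3 a b c /\ b - a <= span3 a b c) /\
  (a - c <= span3 a b c /\ c - a <= span3 a b c) /\
  (b - c <= span3 a b c /\ c - b <= span3 a b c).
Proof.
  unfold span3, Rmax, Rmin; repeat destruct Rle_dec; lra.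
Qed.

(** With [span3_bounds] this exhibits the span as the maximum of the six signed differences, the
    only description of it used in the estimates. *)
Lemma span3_attained (a b c : R) :
  span3 a b c = a - b \/ span3 a b c = b - a \/ span3 a b c = a - c \/
  span3 a b c = c - a \/ span3 a b c = b - c \/ span3 a b c = c - b.
Proof.
  unfold span3, Rmax, Rmin; repeat destruct Rle_dec;
    try (left; lra); right; try (left; lra); right; try (left; lra);
    right; try (left; lra); right; try (left; lra); right; lra.
Qed.

Lemma span3_lipschitz (a a' b c : R) :
  span3 a' b c <= span3 a b c + Rabs (a' - a).
Proof.
  assert (Hm := span3_bounds a b c).
  unfold Rabs; destruct Rcase_abs;
    destruct (span3_attained a' b c) as [e|[e|[e|[e|[e|e]]]]]; rewrite e; lra.
Qed.

Lemma span3_diag (a c : R) : span3 a a c = Rabs (a - c).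
Proof.
  unfold span3, Rmax, Rmin, Rabs; repeat destruct Rle_dec; destruct Rcase_abs; lra.
Qed.

(** The expression [phi_i] with its time-dependent ingredients made free: price [pr], demand [X],
    average demand [Y], target demand [A], supply [W], time [T] since the last update; [be] stands
    for [lambda * alpha1] and [al] for [alpha2]. This allows states that never occur in time to be
    compared. *)
Definition good_potential (be al pr X Y A W T : R) : R :=
  pr * (span3 X Y A - be * T * Rabs (Y - A) + al * Rabs (A - W)).

Lemma good_potential_lipschitz (be al pr X X' Y A W T : R) :
  0 <= pr ->
  good_potential be al pr X' Y A W T
    <= good_potential be al pr X Y A W T + pr * Rabs (X' - X).
Proof.
  intros Hp; unfold good_potential.
  assert (H := span3_lipschitz X X' Y A). nra.
Qed.

Lemma good_potential_updated (be al pr X A W : R) :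
  good_potential be al pr X X A W 0 = pr * (Rabs (X - A) + al * Rabs (A - W)).
Proof. unfold good_potential; rewrite span3_diag; ring. Qed.

(** Everything is measured against the target [a]: the error is at most [a / 2] and
    [w <= 3 / 2 * a]. The two entries of [Rmax (3 / 2) (d - 1)] give the last two inequalities; in a
    price rise the former serves the uncapped change and the latter the capped one. *)
Lemma target_slack (a w d al1 al2 : R) :
  0 < w -> Rabs (a - w) <= w / 3 -> 0 < al1 -> 1 < al2 ->
  al2 / 2 + al1 * Rmax (3 / 2) (d - 1) <= 1 ->
  0 < a /\ 2 * w <= 3 * a /\ 3 * a <= 4 * w /\ Rabs (a - w) <= a / 2 /\
  al1 * w + al2 * Rabs (a - w) <= a /\
  al1 * (d - 1) * a + al2 * Rabs (a - w) <= a.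
Proof.
  intros Hw He H1 H2 H3.
  assert (Ha : 2 * w <= 3 * a /\ 3 * a <= 4 * w).
  { revert He; unfold Rabs; destruct Rcase_abs; lra. }
  assert (Ha2 : Rabs (a - w) <= a / 2) by lra.
  assert (Hm1 := Rmax_l (3 / 2) (d - 1)).
  assert (Hm2 := Rmax_r (3 / 2) (d - 1)).
  assert (H4 : al2 / 2 + al1 * (3 / 2) <= 1) by nra.
  assert (H5 : al2 / 2 + al1 * (d - 1) <= 1) by nra.
  repeat split; try lra; nra.
Qed.

(** While [x'] stays above the target, it cancels against the spending, and the extra [mu * a] of
    spending at target level must pay for the lost discount [be * (y - a)] and the dearer error
    term. If [x'] drops below the target, twice the fall of demand must be paid from [y - a]; the
    fall is at most [E * mu * d * a], and [mu * a <= 4 / 3 * la * (y - a)] because [a <= 4 / 3 * w].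
    This explains [2 * E * d] and [4 / 3]. *)
Lemma price_rise_step (be al1 al2 la E d p x x' y a w T mu : R) :
  0 < p -> 0 < x -> 0 < x' -> 0 < w -> 0 <= T <= 1 ->
  Rabs (a - w) <= w / 3 -> x <= d * a -> 2 <= d -> 1 <= E ->
  0 < la -> 0 < al1 -> 1 < al2 -> be = la * al1 -> be <= 1 / 2 ->
  al2 / 2 + al1 * Rmax (3 / 2) (d - 1) <= 1 ->
  be + 4 / 3 * la * (1 + 2 * E * d + 1 / 2 * al2) <= 1 ->
  a <= y -> 0 <= mu <= la -> mu * w <= la * (y - a) ->
  (mu = la \/ mu * w = la * (y - a)) ->
  x * (1 - E * mu) <= x' ->
  good_potential be al2 (p * (1 + mu)) x' x' a w 0 - p * (1 + mu) * x'
    <= good_potential be al2 p x y a w T - p * x.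
Proof.
  intros Hp Hx Hx' Hw HT He Hxd Hd HE Hla Ha1 Ha2 Hbe Hbe2 H1 H3 Hy Hmu Hmw Hcap Hxx.
  destruct (target_slack a w d al1 al2) as (Ha & Haw & Haw' & Hea & Hs1 & Hs2); auto.
  rewrite good_potential_updated. unfold good_potential.
  rewrite (Rabs_pos_eq (y - a)) by lra.
  set (e := Rabs (a - w)) in *.
  assert (He0 : 0 <= e) by apply Rabs_pos.
  destruct (span3_bounds x y a) as (HS0 & _ & (HS1 & _) & (HS2 & _)).
  assert (HSyx : y - x <= span3 x y a) by (destruct (span3_bounds x y a); lra).
  set (S := span3 x y a) in *.
  assert (Hbe0 : 0 < be) by nra.
  assert (HbT : be * T * (y - a) <= be * (y - a)).
  { rewrite Rmult_assoc. apply Rmult_le_compat_l; nra. }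
  enough (G : (1 + mu) * (Rabs (x' - a) + al2 * e) - (1 + mu) * x'
            <= S - be * T * (y - a) + al2 * e - x).
  { apply (Rmult_le_compat_l p) in G; lra. }
  destruct (Rle_dec a x') as [Hc|Hc].
  - rewrite Rabs_pos_eq by lra.
    enough (0 <= S - (x - a) + mu * (a - al2 * e) - be * (y - a)) by lra.
    destruct Hcap as [Hcap|Hcap].
    (* If [y <= x], the excess [y - a] is at most [(d - 1) * a]. Otherwise it splits into [y - x],
       covered by the span since [be < 1], and [x - a], which is at most [(d - 1) * a]. *)
    + subst mu be. destruct (Rle_dec y x) as [Hyx|Hyx].
      * assert (y - a <= (d - 1) * a) by nra.
        assert (al1 * (y - a) <= a - al2 * e) by nra.
        assert (la * (al1 * (y - a)) <= la * (a - al2 * e)) by (apply Rmult_le_compat_l; lra).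
        lra.
      * assert (al1 * (x - a) <= a - al2 * e) by nra.
        assert (la * (al1 * (x - a)) <= la * (a - al2 * e)) by (apply Rmult_le_compat_l; lra).
        assert (0 <= (1 - la * al1) * (y - x)) by (apply Rmult_le_pos; lra).
        lra.
    + assert (mu * (al1 * w) <= mu * (a - al2 * e)) by (apply Rmult_le_compat_l; lra).
      assert (be * (y - a) = mu * (al1 * w)).
      { rewrite Hbe. replace (mu * (al1 * w)) with (al1 * (mu * w)) by ring. rewrite Hcap; ring. }
      lra.
  - rewrite Rabs_left by lra.
    assert (Hk : 2 * (E * mu * x) + mu * a + mu * (al2 * e) + be * (y - a) <= y - a).
    { assert (E * mu * x <= E * mu * (d * a)).
      { apply Rmult_le_compat_l; [apply Rmult_le_pos; lra | lra]. }
      assert (mu * (al2 * e) <= mu * (al2 * (a / 2))).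
      { apply Rmult_le_compat_l; [lra|]. apply Rmult_le_compat_l; lra. }
      assert (mu * a <= 4 / 3 * la * (y - a)) by nra.
      assert (0 <= 1 + 2 * E * d + 1 / 2 * al2) by nra.
      assert ((mu * a) * (1 + 2 * E * d + 1 / 2 * al2)
              <= 4 / 3 * la * (y - a) * (1 + 2 * E * d + 1 / 2 * al2))
        by (apply Rmult_le_compat_r; lra).
      assert ((be + 4 / 3 * la * (1 + 2 * E * d + 1 / 2 * al2)) * (y - a) <= 1 * (y - a))
        by (apply Rmult_le_compat_r; lra).
      lra. }
    assert (0 <= mu * x') by nra.
    assert (- (x - a) - S <= - (y - a)) by lra.
    lra.
Qed.

(** The mirror image of a rise, with spending added. Elasticity now bounds the new demand only
    through [x' * (1 - E * mu) <= x], so the growth of demand carries the factor [1 / (1 - la * E)].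
    Positivity of [y] caps the shortage [a - y] by [a] when the price change is capped. *)
Lemma price_cut_step (be al1 al2 la E d p x x' y a w T mu : R) :
  0 < p -> 0 < x -> 0 < x' -> 0 < w -> 0 <= T <= 1 ->
  Rabs (a - w) <= w / 3 -> 0 < y -> x <= d * a -> 2 <= d -> 1 <= E ->
  0 < la -> la * E < 1 -> 0 < al1 -> 1 < al2 -> be = la * al1 -> be <= 1 / 2 ->
  al2 / 2 + al1 * Rmax (3 / 2) (d - 1) <= 1 ->
  be + 4 / 3 * la * (2 * E * d / (1 - la * E)) <= 1 ->
  y <= a -> 0 <= mu <= la -> mu * w <= la * (a - y) ->
  (mu = la \/ mu * w = la * (a - y)) ->
  x' * (1 - E * mu) <= x ->
  good_potential be al2 (p * (1 - mu)) x' x' a w 0 + p * (1 - mu) * x'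
    <= good_potential be al2 p x y a w T + p * x.
Proof.
  intros Hp Hx Hx' Hw HT He Hy0 Hxd Hd HE Hla HlE Ha1 Ha2 Hbe Hbe2 H1 H3 Hy Hmu Hmw Hcap Hxx.
  destruct (target_slack a w d al1 al2) as (Ha & Haw & Haw' & Hea & Hs1 & Hs2); auto.
  rewrite good_potential_updated. unfold good_potential.
  rewrite (Rabs_left1 (y - a)) by lra.
  set (e := Rabs (a - w)) in *.
  assert (He0 : 0 <= e) by apply Rabs_pos.
  destruct (span3_bounds x y a) as (HS0 & (HSxy & HSyx) & (HS1 & HS1') & (HS2 & HS2')).
  set (S := span3 x y a) in *.
  assert (Hbe0 : 0 < be) by nra.
  assert (HbT : be * T * - (y - a) <= be * (a - y)).
  { rewrite Rmult_assoc. apply Rmult_le_compat_l; nra. }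
  assert (Hmue : 0 <= mu * (al2 * e)).
  { apply Rmult_le_pos; [lra|]. apply Rmult_le_pos; lra. }
  enough (G : (1 - mu) * (Rabs (x' - a) + al2 * e) + (1 - mu) * x'
            <= S - be * T * - (y - a) + al2 * e + x).
  { apply (Rmult_le_compat_l p) in G; lra. }
  assert (Hal1 : al1 <= 1) by (assert (Hm := Rmax_l (3 / 2) (d - 1)); nra).
  assert (HlaE : la <= 1) by nra.
  destruct (Rle_dec x' a) as [Hc|Hc].
  - rewrite Rabs_left1 by lra.
    enough (be * (a - y) <= mu * a) by lra.
    destruct Hcap as [Hcap|Hcap].
    + subst mu be. rewrite Rmult_assoc. apply Rmult_le_compat_l; nra.
    + assert (be * (a - y) = mu * (al1 * w)).
      { rewrite Hbe. replace (mu * (al1 * w)) with (al1 * (mu * w)) by ring. rewrite Hcap; ring. }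
      rewrite H. apply Rmult_le_compat_l; nra.
  - rewrite Rabs_pos_eq by lra.
    assert (Hk : 2 * (x' - x) + be * (a - y) <= a - y).
    { set (K := 2 * E * d / (1 - la * E)) in *.
      assert (HK : K * (1 - la * E) = 2 * E * d) by (unfold K; field; lra).
      assert (HEmu : E * mu <= la * E) by nra.
      assert (Hq : (x' - x) * (1 - la * E) <= E * mu * (d * a)).
      { assert ((x' - x) * (1 - E * mu) <= E * mu * x) by lra.
        assert (E * mu * x <= E * mu * (d * a)).
        { apply Rmult_le_compat_l; [apply Rmult_le_pos; lra | lra]. }
        destruct (Rle_dec x x') as [Hxx'|Hxx'].
        - assert ((x' - x) * (1 - la * E) <= (x' - x) * (1 - E * mu))
            by (apply Rmult_le_compat_l; lra).
          lra.
        - assert ((x' - x) * (1 - la * E) <= 0) by nra.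
          assert (0 <= E * mu * x) by (apply Rmult_le_pos; [apply Rmult_le_pos; lra | lra]).
          lra. }
      assert (Hma : mu * a <= 4 / 3 * la * (a - y)) by nra.
      assert (Hq2 : 2 * (x' - x) * (1 - la * E) <= K * (4 / 3 * la * (a - y)) * (1 - la * E)).
      { assert (2 * E * d * (mu * a) <= 2 * E * d * (4 / 3 * la * (a - y)))
          by (apply Rmult_le_compat_l; nra).
        replace (K * (4 / 3 * la * (a - y)) * (1 - la * E))
          with ((K * (1 - la * E)) * (4 / 3 * la * (a - y))) by ring.
        rewrite HK. lra. }
      apply Rmult_le_reg_r in Hq2; [|lra].
      assert ((be + 4 / 3 * la * K) * (a - y) <= 1 * (a - y)) by (apply Rmult_le_compat_r; lra).
      lra. }
    assert (0 <= mu * (2 * x' - a)) by (apply Rmult_le_pos; lra).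
    lra.
Qed.

(** * One-sided slopes *)

(** The supremum of the points up to which [P] holds throughout is reached by the left condition and
    passed by the right one. Induction along the time axis avoids merging the update times of all
    goods into one list. *)
Lemma real_induction (P : R -> Prop) (a b : R) :
  a <= b -> P a ->
  (forall t, a <= t < b -> P t ->
     exists del, 0 < del /\ forall r, t < r < t + del -> r <= b -> P r) ->
  (forall t, a < t <= b -> (forall r, a <= r < t -> P r) -> P t) ->
  P b.
Proof.
  intros Hab Ha Hr Hl.
  set (S := fun s => a <= s <= b /\ forall r, a <= r <= s -> P r).
  assert (HSa : S a).
  { split; [lra|]. intros r Hr'. replace r with a by lra. exact Ha. }
  destruct (completeness S) as [m [Hub Hlub]].
  { exists b. intros s [Hs _]; lra. }
  { exists a; exact HSa. }
  assert (Ham : a <= m) by (apply Hub; exact HSa).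
  assert (Hmb : m <= b) by (apply Hlub; intros s [Hs _]; lra).
  assert (Hbelow : forall r, a <= r < m -> P r).
  { intros r Hrm. destruct (Classical_Prop.classic (exists s, S s /\ r <= s)) as [(s & [_ Hs] & Hrs)|Hno].
    - apply Hs; lra.
    - exfalso. assert (m <= r); [|lra].
      apply Hlub. intros s Hs. destruct (Rle_dec s r); [assumption|].
      exfalso; apply Hno; exists s; split; [exact Hs|lra]. }
  assert (Hm : P m).
  { destruct (Req_dec_T a m) as [<-|]; [exact Ha|]. apply Hl; [lra|exact Hbelow]. }
  destruct (Req_dec_T m b) as [<-|Hne]; [exact Hm|].
  destruct (Hr m) as (del & Hdel & Hd); [lra|exact Hm|].
  set (s := Rmin b (m + del / 2)).
  assert (Hs : m < s <= b /\ s < m + del).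
  { unfold s; unfold Rmin; destruct Rle_dec; lra. }
  assert (s <= m); [|lra].
  apply Hub. split; [lra|]. intros r Hrs.
  destruct (Rlt_dec r m); [apply Hbelow; lra|].
  destruct (Req_dec_T r m) as [->|]; [exact Hm|].
  apply Hd; lra.
Qed.

(* An upper bound [M] on the upper right Dini derivative at [0] of [f], normalised to the
   value [v]: [f] itself may be smaller than [v] near [0]. *)
Definition right_slope_le (f : R -> R) (v M : R) : Prop :=
  forall eps, 0 < eps ->
    exists del, 0 < del /\ forall h, 0 < h < del -> f h <= v + (M + eps) * h.

Lemma right_slope_le_weaken (f : R -> R) (v M M' : R) :
  M <= M' -> right_slope_le f v M -> right_slope_le f v M'.
Proof.
  intros HM H eps Heps. destruct (H eps Heps) as (del & Hdel & Hd).
  exists del; split; [exact Hdel|]. intros h Hh. specialize (Hd h Hh). nra.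
Qed.

(** A branch that starts strictly below [v] stays below every line through [v] for a short time,
    whatever its slope; only branches with [f0 = v] are constrained. This is why slopes need to be
    estimated on active branches only. *)
Lemma right_slope_le_quadratic (f : R -> R) (f0 m K v M del0 : R) :
  0 < del0 -> f0 <= v -> (f0 = v -> m <= M) ->
  (forall h, 0 < h < del0 -> f h <= f0 + m * h + K * (h * h)) ->
  right_slope_le f v M.
Proof.
  intros Hd0 Hv HM Hf eps Heps.
  assert (HK := Rle_abs K). assert (HK0 := Rabs_pos K).
  destruct (Req_dec_T f0 v) as [e|ne].
  - specialize (HM e).
    exists (Rmin del0 (eps / (Rabs K + 1))). split.
    { apply Rmin_glb_lt; [lra|]. apply Rdiv_lt_0_compat; lra. }
    intros h [Hh0 Hh].
    assert (Hh1 : h < del0) by (eapply Rlt_le_trans; [exact Hh|apply Rmin_l]).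
    assert (Hh2 : h < eps / (Rabs K + 1)) by (eapply Rlt_le_trans; [exact Hh|apply Rmin_r]).
    apply (Rmult_lt_compat_r (Rabs K + 1)) in Hh2; [|lra].
    unfold Rdiv in Hh2; rewrite Rmult_assoc, Rinv_l, Rmult_1_r in Hh2 by lra.
    specialize (Hf h (conj Hh0 Hh1)).
    assert (K * (h * h) <= eps * h) by (assert (K * h <= eps) by nra; nra).
    nra.
  - assert (Hg : 0 < v - f0) by lra.
    set (C := Rabs (m - M) + Rabs K + 1).
    assert (HmM := Rle_abs (m - M)). assert (HmM0 := Rabs_pos (m - M)).
    assert (HC : 0 < C) by (unfold C; lra).
    exists (Rmin del0 (Rmin 1 ((v - f0) / C))). split.
    { repeat apply Rmin_glb_lt; try lra. apply Rdiv_lt_0_compat; lra. }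
    intros h [Hh0 Hh].
    assert (Hh1 : h < del0) by (eapply Rlt_le_trans; [exact Hh|apply Rmin_l]).
    assert (Hh' : h < Rmin 1 ((v - f0) / C)) by (eapply Rlt_le_trans; [exact Hh|apply Rmin_r]).
    assert (Hh2 : h < 1) by (eapply Rlt_le_trans; [exact Hh'|apply Rmin_l]).
    assert (Hh3 : h < (v - f0) / C) by (eapply Rlt_le_trans; [exact Hh'|apply Rmin_r]).
    apply (Rmult_lt_compat_r C) in Hh3; [|lra].
    unfold Rdiv in Hh3; rewrite Rmult_assoc, Rinv_l, Rmult_1_r in Hh3 by lra.
    specialize (Hf h (conj Hh0 Hh1)).
    assert (K * (h * h) <= Rabs K * h) by (assert (K * h <= Rabs K) by nra; nra).
    assert ((m - M) * h <= Rabs (m - M) * h) by (apply Rmult_le_compat_r; lra).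
    unfold C in Hh3. assert (0 < eps * h) by nra. lra.
Qed.

Lemma right_slope_le_finite_max (I : Type) (l : list I) (g : I -> R -> R)
    (f : R -> R) (v M del0 : R) :
  0 < del0 ->
  (forall i, List.In i l -> right_slope_le (g i) v M) ->
  (forall h, 0 < h < del0 -> exists i, List.In i l /\ f h <= g i h) ->
  right_slope_le f v M.
Proof.
  intros Hd0 Hg Hf eps Heps.
  assert (H : exists del, 0 < del /\
    forall h i, 0 < h < del -> List.In i l -> g i h <= v + (M + eps) * h).
  { clear Hf. induction l as [|j l IH].
    - exists 1; split; [lra|]. intros h i _ [].
    - destruct IH as (d1 & Hd1 & H1); [intros i Hi; apply Hg; right; exact Hi|].
      destruct (Hg j (or_introl eq_refl) eps Heps) as (d2 & Hd2 & H2).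
      exists (Rmin d1 d2); split; [apply Rmin_glb_lt; lra|].
      intros h i [Hh0 Hh] Hi.
      assert (h < d1) by (eapply Rlt_le_trans; [exact Hh|apply Rmin_l]).
      assert (h < d2) by (eapply Rlt_le_trans; [exact Hh|apply Rmin_r]).
      destruct Hi as [<-|Hi]; [apply H2; lra|apply H1; [lra|exact Hi]]. }
  destruct H as (del & Hdel & H).
  exists (Rmin del del0); split; [apply Rmin_glb_lt; lra|].
  intros h [Hh0 Hh].
  assert (h < del) by (eapply Rlt_le_trans; [exact Hh|apply Rmin_l]).
  assert (h < del0) by (eapply Rlt_le_trans; [exact Hh|apply Rmin_r]).
  destruct (Hf h) as (i & Hi & Hle); [lra|].
  eapply Rle_trans; [exact Hle|]. apply H; [lra|exact Hi].
Qed.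

Lemma rsum_le (n : nat) (f g : nat -> R) :
  (forall i, (i < n)%nat -> f i <= g i) -> rsum n f <= rsum n g.
Proof.
  induction n as [|n IH]; intros H; simpl; [lra|].
  assert (f n <= g n) by (apply H; lia).
  assert (rsum n f <= rsum n g) by (apply IH; intros; apply H; lia). lra.
Qed.

Lemma rsum_ext (n : nat) (f g : nat -> R) :
  (forall i, (i < n)%nat -> f i = g i) -> rsum n f = rsum n g.
Proof.
  intros H; apply Rle_antisym; apply rsum_le; intros i Hi; rewrite (H i Hi); lra.
Qed.

Lemma rsum_plus (n : nat) (f g : nat -> R) :
  rsum n (fun i => f i + g i) = rsum n f + rsum n g.
Proof. induction n as [|n IH]; simpl; [ring|rewrite IH; ring]. Qed.

Lemma rsum_scal (n : nat) (c : R) (f : nat -> R) :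
  rsum n (fun i => c * f i) = c * rsum n f.
Proof. induction n as [|n IH]; simpl; [ring|rewrite IH; ring]. Qed.

Lemma right_slope_le_rsum (n : nat) (f : nat -> R -> R) (v M : nat -> R) :
  (forall i, (i < n)%nat -> right_slope_le (f i) (v i) (M i)) ->
  right_slope_le (fun h => rsum n (fun i => f i h)) (rsum n v) (rsum n M).
Proof.
  induction n as [|n IH]; intros H eps Heps; simpl.
  - exists 1; split; [lra|]. intros h Hh. nra.
  - destruct (IH (fun i Hi => H i (Nat.lt_lt_succ_r _ _ Hi)) (eps / 2)) as (d1 & Hd1 & H1); [lra|].
    destruct (H n (Nat.lt_succ_diag_r n) (eps / 2)) as (d2 & Hd2 & H2); [lra|].
    exists (Rmin d1 d2); split; [apply Rmin_glb_lt; lra|].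
    intros h [Hh0 Hh].
    assert (h < d1) by (eapply Rlt_le_trans; [exact Hh|apply Rmin_l]).
    assert (h < d2) by (eapply Rlt_le_trans; [exact Hh|apply Rmin_r]).
    specialize (H1 h ltac:(lra)); specialize (H2 h ltac:(lra)). simpl in H1. lra.
Qed.

(* The affine barrier from [f t0] down to [(1 - rho / 2) * f t0] cannot be crossed: where [f]
   meets it, [f >= f t0 / 2], so [f] falls there at rate at least [rho / 2 * f t0]. *)
Lemma unit_time_decay (f : R -> R) (t0 rho : R) :
  0 <= rho <= 1 -> 0 <= f t0 ->
  (forall t, t0 <= t < t0 + 1 -> right_slope_le (fun h => f (t + h)) (f t) (- rho * f t)) ->
  (forall t, t0 < t <= t0 + 1 -> forall eps, 0 < eps ->
     exists del, 0 < del /\ forall r, t - del < r < t -> f t <= f r + eps) ->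
  f (t0 + 1) <= (1 - rho / 2) * f t0.
Proof.
  intros Hrho Hf0 Hr Hl.
  (* The slack [eta] tilts the barrier upwards, so that wherever [f] meets it the slope of [f] is
     smaller by at least [eta]. *)
  apply Rle_plus_epsilon. intros eta Heta.
  set (sl := - (rho / 2 * f t0) + eta).
  set (B := fun s => f t0 + sl * (s - t0)).
  replace ((1 - rho / 2) * f t0 + eta) with (B (t0 + 1)) by (unfold B, sl; lra).
  apply (real_induction (fun s => f s <= B s) t0 (t0 + 1)); [lra| | |].
  - unfold B; lra.
  - intros t Ht HB.
    assert (Hq : right_slope_le (fun h => f (t + h) - sl * h) (B t) (- eta / 2)).
    { intros eps Heps. destruct (Rle_lt_or_eq_dec _ _ HB) as [Hlt|Heq].
      (* Strictly below the barrier any finite slope is good enough: [f] is bounded by a line that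
         cannot reach the barrier within a short time. *)
      - apply (right_slope_le_quadratic (fun h => f t + (- rho * f t + 1 - sl) * h)
                 (f t) (- rho * f t + 1 - sl) 0 (B t) (- eta / 2) 1) in Heps; try lra.
        + destruct Heps as (d1 & Hd1 & H1).
          destruct (Hr t Ht 1) as (d2 & Hd2 & H2); [lra|].
          exists (Rmin d1 d2); split; [apply Rmin_glb_lt; lra|]. intros h [Hh0 Hh].
          assert (h < d1) by (eapply Rlt_le_trans; [exact Hh|apply Rmin_l]).
          assert (h < d2) by (eapply Rlt_le_trans; [exact Hh|apply Rmin_r]).
          specialize (H1 h ltac:(lra)); specialize (H2 h ltac:(lra)). lra.
        + intros h Hh; lra.
      - destruct (Hr t Ht (eta / 2)) as (d2 & Hd2 & H2); [lra|].
        exists d2; split; [exact Hd2|]. intros h Hh. specialize (H2 h Hh).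
        assert (Hhalf : f t0 / 2 <= f t).
        { rewrite Heq; unfold B, sl.
          assert (0 <= eta * (t - t0)) by nra.
          assert (rho / 2 * f t0 * (t - t0) <= 1 / 2 * f t0 * 1).
          { apply Rmult_le_compat; try nra. }
          lra. }
        assert (- rho * f t + eta / 2 - sl <= - eta / 2) by (unfold sl; nra).
        assert ((- rho * f t + eta / 2 - sl) * h <= (- eta / 2 + eps) * h)
          by (apply Rmult_le_compat_r; lra).
        lra. }
    destruct (Hq (eta / 2)) as (del & Hdel & Hd); [lra|].
    exists del; split; [exact Hdel|]. intros r Hrt _.
    specialize (Hd (r - t) ltac:(lra)). replace (t + (r - t)) with r in Hd by ring.
    unfold B in Hd |- *. lra.
  - intros t Ht HB. apply Rle_plus_epsilon. intros eps Heps.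
    destruct (Hl t Ht (eps / 2)) as (del & Hdel & Hd); [lra|].
    assert (Hsl := Rle_abs (- sl)). assert (Hsl0 := Rabs_pos (- sl)).
    set (C := Rabs (- sl) + 1).
    set (z := Rmin (del / 2) (Rmin (t - t0) (eps / 2 / C))).
    assert (HC : 0 < C) by (unfold C; lra).
    assert (Hz0 : 0 < z).
    { repeat apply Rmin_glb_lt; try lra. apply Rdiv_lt_0_compat; lra. }
    assert (Hz1 : z <= del / 2) by apply Rmin_l.
    assert (Hz' : z <= Rmin (t - t0) (eps / 2 / C)) by apply Rmin_r.
    assert (Hz2 : z <= t - t0) by (eapply Rle_trans; [exact Hz'|apply Rmin_l]).
    assert (Hz3 : z <= eps / 2 / C) by (eapply Rle_trans; [exact Hz'|apply Rmin_r]).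
    apply (Rmult_le_compat_r C) in Hz3; [|lra].
    replace (eps / 2 / C * C) with (eps / 2) in Hz3 by (field; lra).
    specialize (Hd (t - z) ltac:(lra)). specialize (HB (t - z) ltac:(lra)).
    unfold B in HB |- *.
    assert (- sl * z <= Rabs (- sl) * z) by (apply Rmult_le_compat_r; lra).
    unfold C in Hz3. lra.
Qed.

(** * The flow between updates *)

(** Coefficient vectors of the six signed differences. As an inductive family, case analysis turns
    the coefficients into numerals and leaves linear goals; closure under negation carries the
    reflection argument below. *)
Inductive pair_coeff : R -> R -> R -> Prop :=
| pair_xy : pair_coeff 1 (-1) 0
| pair_yx : pair_coeff (-1) 1 0
| pair_xa : pair_coeff 1 0 (-1)
| pair_ax : pair_coeff (-1) 0 1
| pair_ya : pair_coeff 0 1 (-1)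
| pair_ay : pair_coeff 0 (-1) 1.

Lemma pair_coeff_opp (c1 c2 c3 : R) :
  pair_coeff c1 c2 c3 -> pair_coeff (- c1) (- c2) (- c3).
Proof.
  assert (H1 : - (-1) = 1) by ring. assert (H2 : - (1) = -1) by ring.
  intros [| | | | |]; rewrite ?H1, ?H2, ?Ropp_0; constructor.
Qed.

Lemma span3_pair (a b c : R) :
  exists c1 c2 c3, pair_coeff c1 c2 c3 /\ span3 a b c = c1 * a + c2 * b + c3 * c.
Proof.
  destruct (span3_attained a b c) as [e|[e|[e|[e|[e|e]]]]]; rewrite e;
    [exists 1, (-1), 0|exists (-1), 1, 0|exists 1, 0, (-1)
    |exists (-1), 0, 1|exists 0, 1, (-1)|exists 0, (-1), 1];
    (split; [constructor|ring]).
Qed.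

Lemma pair_le_span3 (c1 c2 c3 a b c : R) :
  pair_coeff c1 c2 c3 -> c1 * a + c2 * b + c3 * c <= span3 a b c.
Proof. assert (H := span3_bounds a b c). intros [| | | | |]; lra. Qed.

(* Sign of [y - a] just after the current time: ties are broken by the first, then by the
   second derivative of [T * (y - a)]. *)
Definition right_sign_pos (x y a w : R) : Prop :=
  a < y \/ (y = a /\ (a < x \/ (x = a /\ w <= x))).

Lemma right_sign_total (x y a w : R) :
  right_sign_pos x y a w \/ right_sign_pos (- x) (- y) (- a) (- w).
Proof. unfold right_sign_pos; lra. Qed.

(** [m] is the slope of an active branch: [c * (x - y)] is the speed of the average,
    [kappa * (w - x)] that of the target, and the term after [be] is the derivative of
    [T * (y - a)]. The sign condition makes the discount work: on the branch [x - a] it contributes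
    [- be * (x - a)], and on [y - a] it combines with the motion of the average, where [c >= 1] is
    used. The target drift costs at most [kappa * (1 + al)] times the span, a quarter of
    [be * S]. *)
Lemma active_slope_bound_pos (kappa be al T c x y a w sg c1 c2 c3 S e : R) :
  0 < kappa -> 1 < al < 2 -> 4 * kappa * (1 + al) <= be -> be <= 1 / 2 ->
  0 <= T <= 1 -> 1 <= c ->
  right_sign_pos x y a w ->
  pair_coeff c1 c2 c3 ->
  x - y <= S -> y - x <= S -> x - a <= S -> a - x <= S -> y - a <= S -> a - y <= S ->
  c1 * x + c2 * y + c3 * a = S ->
  sg = 1 \/ sg = -1 -> sg * (a - w) = e -> 0 <= e ->
  let m := c2 * (c * (x - y)) + c3 * (kappa * (w - x))
           - be * (x - a - T * (kappa * (w - x))) + al * sg * (kappa * (w - x)) in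
  m <= - (kappa * (al - 1) / 2) * (S + al * e) /\ m <= - (3 / 4 * be) * S.
Proof.
  intros Hk Hal Hkb Hb HT Hc Hs Hp Sxy Syx Sxa Sax Sya Say HS Hsg He He0 m.
  set (r := be * T).
  assert (Hbe0 : 0 < be) by nra.
  assert (Hr : 0 <= r <= 1 / 2) by (unfold r; split; nra).
  assert (Hk8 : kappa * (1 + al) <= 1 / 8) by lra.
  assert (HbT : forall z, be * (x - a - T * z) = be * (x - a) - r * z)
    by (intros; unfold r; ring).
  unfold m; rewrite HbT; clear m HbT; clearbody r.
  assert (Hprod : forall z, 0 <= z ->
     0 <= kappa * z /\ 0 <= r * (kappa * z) <= kappa * z / 2 /\
     kappa * z <= al * (kappa * z) <= 2 * (kappa * z) /\
     0 <= al * (al * (kappa * z)) <= 3 * (al * (kappa * z)) - 2 * (kappa * z) /\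
     4 * (kappa * z) + 4 * (al * (kappa * z)) <= be * z /\ be * z <= z / 2).
  { intros z Hz. assert (Hkz : 0 <= kappa * z) by nra.
    assert (0 <= al * (kappa * z)) by nra.
    assert (0 <= (al - 1) * (2 - al) * (kappa * z))
      by (repeat apply Rmult_le_pos; lra).
    repeat split; try nra. }
  assert (He' := Hprod e He0).
  unfold right_sign_pos in Hs.
  destruct Hp.
  - assert (y = a) by lra. subst y. assert (HD := Hprod (x - a) ltac:(lra)).
    assert (Hcc : x - a <= c * (x - a)) by nra.
    destruct Hsg; subst sg; [replace w with (a - e) in * by lra|replace w with (a + e) in * by lra];
      subst S; lra.
  - assert (HD := Hprod (a - x) ltac:(lra)). assert (HF := Hprod (y - x) ltac:(lra)).
    assert (HG := Hprod (y - a) ltac:(lra)).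
    assert (Hcc : y - x <= c * (y - x)) by nra.
    destruct Hsg; subst sg; [replace w with (a - e) in * by lra|replace w with (a + e) in * by lra];
      subst S; split; lra.
  - assert (HD := Hprod (x - a) ltac:(lra)).
    destruct Hsg; subst sg; [replace w with (a - e) in * by lra|replace w with (a + e) in * by lra];
      subst S; split; lra.
  - assert (x = a) by lra. assert (y = a) by lra. subst x y.
    destruct Hsg; subst sg; [replace w with (a - e) in * by lra|assert (e = 0) by lra; replace w with a in * by lra];
      subst S; split; lra.
  - assert (HD := Hprod (x - a) ltac:(lra)). assert (HF := Hprod (y - x) ltac:(lra)).
    assert (Hcc : y - x <= c * (y - x)) by nra.
    destruct Hsg; subst sg; [replace w with (a - e) in * by lra|replace w with (a + e) in * by lra];
      subst S; split; lra.
  - assert (x = a) by lra. assert (y = a) by lra. subst x y.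
    destruct Hsg; subst sg; [replace w with (a - e) in * by lra|assert (e = 0) by lra; replace w with a in * by lra];
      subst S; split; lra.
Qed.

(** The sign [s] is chosen before the branch: [- |z| <= - s * z] holds for either sign, so one [s]
    suffices for all branches. The negative case is the positive one after reflecting [x], [y], [a]
    and [w]. *)
Lemma active_slope_bound (kappa be al T c x y a w : R) :
  0 < kappa -> 1 < al < 2 -> 4 * kappa * (1 + al) <= be -> be <= 1 / 2 ->
  0 <= T <= 1 -> 1 <= c ->
  exists s, s * (y - a) = Rabs (y - a) /\ (s = 1 \/ s = -1) /\
  forall sg c1 c2 c3,
  pair_coeff c1 c2 c3 ->
  c1 * x + c2 * y + c3 * a = span3 x y a ->
  sg = 1 \/ sg = -1 -> sg * (a - w) = Rabs (a - w) ->
  c2 * (c * (x - y)) + c3 * (kappa * (w - x))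
     - be * s * (x - a - T * (kappa * (w - x))) + al * sg * (kappa * (w - x))
  <= - Rmax (kappa * (al - 1) / 2 * (span3 x y a + al * Rabs (a - w)))
            (3 / 4 * be * span3 x y a).
Proof.
  intros Hk Hal Hkb Hb HT Hc.
  destruct (span3_bounds x y a) as (HS0 & (HSxy & HSyx) & (HSxa & HSax) & (HSya & HSay)).
  destruct (right_sign_total x y a w) as [Hs|Hs].
  - exists 1. split; [|split; [lra|]].
    { unfold right_sign_pos in Hs; rewrite Rabs_pos_eq; lra. }
    intros sg c1 c2 c3 Hp HS Hsg He.
    destruct (active_slope_bound_pos kappa be al T c x y a w sg c1 c2 c3
                (span3 x y a) (Rabs (a - w))) as [G1 G2]; auto using Rabs_pos.
    unfold Rmax; destruct Rle_dec; lra.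
  - exists (-1). split; [|split; [lra|]].
    { unfold right_sign_pos in Hs; rewrite Rabs_left1; lra. }
    intros sg c1 c2 c3 Hp HS Hsg He.
    destruct (active_slope_bound_pos kappa be al T c (- x) (- y) (- a) (- w) (- sg)
                (- c1) (- c2) (- c3) (span3 x y a) (Rabs (a - w))) as [G1 G2];
      auto using Rabs_pos, pair_coeff_opp; try lra.
    unfold Rmax; destruct Rle_dec; lra.
Qed.

(** For [T > 0] the average moves towards [x] at speed [1 / T] times the distance, and [T <= 1], the
    maximal delay between updates, gives [c >= 1]. For [T = 0] the average is constantly [x], so any
    [c] would do. *)
Lemma running_average_expansion (x y T del0 : R) (Y : R -> R) :
  0 <= T <= 1 -> (T = 0 -> y = x) ->
  (forall h, 0 < h < del0 -> (T + h) * Y h = T * y + h * x) ->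
  exists c K, 1 <= c /\ 0 <= K /\
    forall h, 0 < h < del0 -> Rabs (Y h - y - c * (x - y) * h) <= K * (h * h).
Proof.
  intros HT H0 HY. destruct (Req_dec_T T 0) as [e|ne].
  - exists 1, 0. split; [lra|split; [lra|]]. intros h Hh.
    specialize (HY h Hh). rewrite (H0 e), e in *.
    assert (Y h = x) by (apply Rmult_eq_reg_l with h; lra).
    rewrite H. replace (x - x - 1 * (x - x) * h) with 0 by ring. rewrite Rabs_R0; lra.
  - exists (/ T), (Rabs (y - x) / (T * T)).
    assert (HTT : 0 < T * T) by nra.
    split; [|split].
    + rewrite <- Rinv_1. apply Rinv_le_contravar; lra.
    + apply Rmult_le_pos; [apply Rabs_pos|]. apply Rlt_le, Rinv_0_lt_compat, HTT.
    + intros h Hh. specialize (HY h Hh).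
      replace (Y h) with ((T * y + h * x) / (T + h)) by (rewrite <- HY; field; lra).
      replace ((T * y + h * x) / (T + h) - y - / T * (x - y) * h)
        with ((y - x) * (h * h / (T * (T + h)))) by (field; lra).
      rewrite Rabs_mult. unfold Rdiv at 2. rewrite Rmult_assoc, (Rmult_comm (/ (T * T))).
      apply Rmult_le_compat_l; [apply Rabs_pos|].
      rewrite Rabs_pos_eq.
      * apply Rmult_le_compat_l; [nra|]. apply Rinv_le_contravar; nra.
      * apply Rlt_le, Rdiv_lt_0_compat; nra.
Qed.

Definition pair_coeffs : list (R * R * R) :=
  ((1, -1, 0) :: (-1, 1, 0) :: (1, 0, -1) :: (-1, 0, 1) :: (0, 1, -1) :: (0, -1, 1) :: nil)%list.

Lemma in_pair_coeffs (c1 c2 c3 : R) :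
  List.In (c1, c2, c3) pair_coeffs <-> pair_coeff c1 c2 c3.
Proof.
  split.
  - intros H; simpl in H.
    repeat (destruct H as [H|H]; [injection H as <- <- <-; constructor|]); contradiction.
  - intros [| | | | |]; simpl; tauto.
Qed.

(* Along the flow between updates, the potential of a good is a maximum of twelve smooth
   branches: the pair realising the span, and the sign of [a - w]. *)
Lemma good_potential_right_slope (kappa be al pr x y a w T del0 : R) (Y A : R -> R) :
  0 < kappa -> 1 < al < 2 -> 4 * kappa * (1 + al) <= be -> be <= 1 / 2 ->
  0 <= T <= 1 -> (T = 0 -> y = x) -> 0 < pr -> 0 < del0 ->
  (forall h, 0 < h < del0 -> (T + h) * Y h = T * y + h * x) ->
  (forall h, 0 < h < del0 -> A h = a + kappa * h * (w - x)) ->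
  right_slope_le (fun h => good_potential be al pr x (Y h) (A h) w (T + h))
    (good_potential be al pr x y a w T)
    (- pr * Rmax (kappa * (al - 1) / 2 * (span3 x y a + al * Rabs (a - w)))
                 (3 / 4 * be * span3 x y a)).
Proof.
  intros Hk Hal Hkb Hb HT H0 Hpr Hd0 HY HA.
  destruct (running_average_expansion x y T del0 Y HT H0 HY) as (c & K & Hc & HK & HYK).
  destruct (active_slope_bound kappa be al T c x y a w) as (s & Hs & Hs1 & Hm); auto.
  assert (Hbe0 : 0 < be) by nra.
  (* The discount appears with the fixed sign [s] and multiplied out as [(T + h) * (Y h - A h)],
     which is quadratic in [h]; only the span needs the expansion of [Y]. *)
  set (g := fun (i : R * R * R * R) h =>
    let '(c1, c2, c3, sg) := i in
    pr * (c1 * x + c2 * Y h + c3 * A h - be * (s * ((T + h) * (Y h - A h)))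
          + al * (sg * (A h - w)))).
  apply (right_slope_le_finite_max _ (List.list_prod pair_coeffs (1 :: -1 :: nil)%list) g _ _ _ del0);
    [exact Hd0| |].
  - intros [[[c1 c2] c3] sg] Hi.
    apply List.in_prod_iff in Hi. destruct Hi as [Hp Hsg].
    apply in_pair_coeffs in Hp.
    assert (Hsg' : sg = 1 \/ sg = -1).
    { simpl in Hsg. destruct Hsg as [<-|[<-|[]]]; auto. }
    assert (Hle1 := pair_le_span3 c1 c2 c3 x y a Hp).
    assert (Hle2 : sg * (a - w) <= Rabs (a - w)).
    { destruct Hsg' as [-> | ->]; unfold Rabs; destruct Rcase_abs; lra. }
    set (m := c2 * (c * (x - y)) + c3 * (kappa * (w - x))
              - be * s * (x - a - T * (kappa * (w - x))) + al * sg * (kappa * (w - x))).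
    apply (right_slope_le_quadratic _
             (pr * (c1 * x + c2 * y + c3 * a - be * T * Rabs (y - a) + al * (sg * (a - w))))
             (pr * m) (pr * (K + be * (kappa * Rabs (w - x)))) _ _ del0 Hd0).
    + unfold good_potential. apply Rmult_le_compat_l; [lra|].
      assert (al * (sg * (a - w)) <= al * Rabs (a - w)) by (apply Rmult_le_compat_l; lra).
      lra.
    + unfold good_potential. intros Heq. apply Rmult_eq_reg_l in Heq; [|lra].
      assert (al * (sg * (a - w)) <= al * Rabs (a - w)) by (apply Rmult_le_compat_l; lra).
      assert (Heq1 : c1 * x + c2 * y + c3 * a = span3 x y a) by lra.
      assert (Heq2 : sg * (a - w) = Rabs (a - w)) by (apply Rmult_eq_reg_l with al; lra).
      specialize (Hm sg c1 c2 c3 Hp Heq1 Hsg' Heq2).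
      replace (- pr * _) with (pr * - Rmax (kappa * (al - 1) / 2 * (span3 x y a + al * Rabs (a - w)))
                 (3 / 4 * be * span3 x y a)) by ring.
      apply Rmult_le_compat_l; [lra|exact Hm].
    + intros h Hh. unfold g.
      replace ((T + h) * (Y h - A h)) with (T * y + h * x - (T + h) * A h)
        by (rewrite <- (HY h Hh); ring).
      rewrite (HA h Hh).
      replace (pr * (c1 * x + c2 * y + c3 * a - be * T * Rabs (y - a) + al * (sg * (a - w))) +
               pr * m * h + pr * (K + be * (kappa * Rabs (w - x))) * (h * h))
        with (pr * (c1 * x + c2 * y + c3 * a - be * T * Rabs (y - a) + al * (sg * (a - w))
                    + m * h + (K + be * (kappa * Rabs (w - x))) * (h * h))) by ring.
      apply Rmult_le_compat_l; [lra|].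
      rewrite <- Hs. specialize (HYK h Hh).
      assert (Hc2 : c2 * (Y h - y - c * (x - y) * h) <= K * (h * h)).
      { revert HYK. generalize (Y h - y - c * (x - y) * h). intros r Hr.
        apply Rabs_le_between in Hr. assert (0 <= K * (h * h)) by nra.
        destruct Hp; lra. }
      assert (Hq : be * (s * (kappa * (w - x) * (h * h))) <= be * (kappa * Rabs (w - x) * (h * h))).
      { apply Rmult_le_compat_l; [lra|].
        assert (s * (w - x) <= Rabs (w - x)).
        { destruct Hs1 as [-> | ->]; unfold Rabs; destruct Rcase_abs; lra. }
        assert (0 <= kappa * (h * h)) by nra.
        assert (kappa * (h * h) * (s * (w - x)) <= kappa * (h * h) * Rabs (w - x))
          by (apply Rmult_le_compat_l; lra).
        lra. }
      unfold m. lra.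
  - intros h Hh.
    destruct (span3_pair x (Y h) (A h)) as (c1 & c2 & c3 & Hp & Hsp).
    assert (Hsg : exists sg, (sg = 1 \/ sg = -1) /\ Rabs (A h - w) = sg * (A h - w)).
    { unfold Rabs; destruct Rcase_abs; [exists (-1)|exists 1]; lra. }
    destruct Hsg as (sg & Hsg & Hab).
    exists (c1, c2, c3, sg). split.
    + apply List.in_prod_iff. split; [apply in_pair_coeffs, Hp|].
      simpl. destruct Hsg; auto.
    + unfold good_potential, g. rewrite Hsp, Hab.
      apply Rmult_le_compat_l; [lra|].
      assert (s * (Y h - A h) <= Rabs (Y h - A h)).
      { destruct Hs1 as [-> | ->]; unfold Rabs; destruct Rcase_abs; lra. }
      assert (0 <= be * (T + h)) by nra.
      assert (be * (T + h) * (s * (Y h - A h)) <= be * (T + h) * Rabs (Y h - A h))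
        by (apply Rmult_le_compat_l; lra).
      lra.
Qed.

(** * Demand *)

Section Demand.

Context (n : nat) (x : nat -> (nat -> R) -> R) (M E : R).
Context (Hdem : market_demand n x M E) (HE : 1 <= E).

Let own (q : nat -> R) (i : nat) (r : R) : R := x i (upd q i r).

Lemma demand_ext (i : nat) (q q' : nat -> R) :
  (forall j, (j < n)%nat -> q j = q' j) -> x i q = x i q'.
Proof. apply Hdem. Qed.

Lemma demand_pos (i : nat) (q : nat -> R) : (i < n)%nat -> posvec n q -> 0 < x i q.
Proof. apply Hdem. Qed.

Lemma upd_same (q : nat -> R) (i : nat) (r : R) : upd q i r i = r.
Proof. unfold upd; now rewrite Nat.eqb_refl. Qed.

Lemma upd_other (q : nat -> R) (i j : nat) (r : R) : j <> i -> upd q i r j = q j.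
Proof. intros H; unfold upd. apply Nat.eqb_neq in H. now rewrite H. Qed.

Lemma posvec_upd (q : nat -> R) (i : nat) (r : R) :
  posvec n q -> 0 < r -> posvec n (upd q i r).
Proof.
  intros Hq Hr j Hj. destruct (Nat.eq_dec j i) as [->|ne].
  - now rewrite upd_same.
  - rewrite upd_other by exact ne. now apply Hq.
Qed.

(** Elasticity is assumed at the current price of good [i]; it reaches any price [r] by applying it
    to the vector [upd q i r]. *)
Lemma own_price_derive (i : nat) (q : nat -> R) (r : R) :
  (i < n)%nat -> posvec n q -> 0 < r ->
  derivable_pt_lim (own q i) r (Derive (own q i) r) /\
  0 < own q i r /\
  Derive (own q i) r <= 0 /\ - Derive (own q i) r * r <= E * own q i r.
Proof.
  intros Hi Hq Hr.
  assert (Hq' := posvec_upd q i r Hq Hr).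
  destruct Hdem as (Hext & Hpos & _ & _ & Hel).
  destruct (Hel i (upd q i r) Hi Hq') as (D & HD & H1 & H2).
  rewrite upd_same in *. fold (own q i r) in *.
  assert (Hown : 0 < own q i r) by (apply Hpos; assumption).
  assert (HD' : is_derive (own q i) r D).
  { apply is_derive_ext with (fun r0 => x i (upd (upd q i r) i r0)).
    - intros t. apply Hext. intros j _. unfold upd. destruct (Nat.eqb j i); reflexivity.
    - now apply is_derive_Reals. }
  rewrite (is_derive_unique _ _ _ HD').
  split; [now apply is_derive_Reals|split; [exact Hown|]].
  assert (0 < own q i r / r) by (apply Rdiv_lt_0_compat; assumption).
  split; [lra|].
  apply (Rmult_le_compat_r r) in H2; [|lra].
  unfold Rdiv in H2. rewrite Rmult_assoc, Rinv_l in H2; lra.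
Qed.

Lemma own_price_anti (i : nat) (q : nat -> R) (r r' : R) :
  (i < n)%nat -> posvec n q -> 0 < r <= r' -> own q i r' <= own q i r.
Proof.
  intros Hi Hq Hr. destruct (Req_dec_T r r') as [->|ne]; [lra|].
  destruct (MVT_cor2 (own q i) (Derive (own q i)) r r') as (c & Hc & Hcr); [lra| |].
  - intros c Hc. apply own_price_derive; [assumption..|lra].
  - destruct (own_price_derive i q c Hi Hq) as (_ & _ & Hneg & _); [lra|]. nra.
Qed.

(** At the intermediate price [c] of the mean value theorem, the fall is [- D * q i * mu <= - D * c
    * mu <= E * mu * own q i c], and demand at [c] is at most demand at [q i]. *)
Lemma own_price_rise (i : nat) (q : nat -> R) (mu : R) :
  (i < n)%nat -> posvec n q -> 0 <= mu ->
  x i q * (1 - E * mu) <= x i (upd q i (q i * (1 + mu))).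
Proof.
  intros Hi Hq Hmu. assert (Hqi := Hq i Hi).
  assert (e : x i q = own q i (q i)).
  { apply demand_ext. intros j _. unfold upd. destruct (Nat.eqb_spec j i); congruence. }
  rewrite e. fold (own q i (q i * (1 + mu))).
  destruct (Req_dec_T mu 0) as [->|ne].
  { replace (q i * (1 + 0)) with (q i) by ring. lra. }
  assert (Hlt : q i < q i * (1 + mu)) by nra.
  destruct (MVT_cor2 (own q i) (Derive (own q i)) (q i) (q i * (1 + mu))) as (c & Hc & Hcr);
    [exact Hlt| |].
  - intros c Hc. apply own_price_derive; [assumption..|lra].
  - destruct (own_price_derive i q c Hi Hq) as (_ & Hpos & Hneg & Hel); [lra|].
    assert (Hanti := own_price_anti i q (q i) c Hi Hq ltac:(lra)).
    assert (- Derive (own q i) c * q i <= - Derive (own q i) c * c)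
      by (apply Rmult_le_compat_l; lra).
    assert (E * own q i c <= E * own q i (q i)) by (apply Rmult_le_compat_l; lra).
    assert (- Derive (own q i) c * q i * mu <= E * own q i (q i) * mu)
      by (apply Rmult_le_compat_r; lra).
    replace (q i * (1 + mu) - q i) with (q i * mu) in Hc by ring. lra.
Qed.

(* With [L s = 1 - E * (1 - s / q i)], the product [own s * L s] is nondecreasing on [s <= q i]. *)
Lemma own_price_cut (i : nat) (q : nat -> R) (mu : R) :
  (i < n)%nat -> posvec n q -> 0 <= mu -> E * mu < 1 ->
  x i (upd q i (q i * (1 - mu))) * (1 - E * mu) <= x i q.
Proof.
  intros Hi Hq Hmu HEm. assert (Hqi := Hq i Hi).
  assert (e : x i q = own q i (q i)).
  { apply demand_ext. intros j _. unfold upd. destruct (Nat.eqb_spec j i); congruence. }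
  rewrite e. fold (own q i (q i * (1 - mu))).
  destruct (Req_dec_T mu 0) as [->|ne].
  { replace (q i * (1 - 0)) with (q i) by ring. lra. }
  assert (Hlt : q i * (1 - mu) < q i) by nra.
  assert (Hmu1 : mu < 1) by nra.
  assert (Hpos : 0 < q i * (1 - mu)) by nra.
  set (L := fun s => 1 - E * (1 - s / q i)).
  set (f' := fun s => Derive (own q i) s * L s + own q i s * (E / q i)).
  destruct (MVT_cor2 (fun s => own q i s * L s) f' (q i * (1 - mu)) (q i)) as (c & Hc & Hcr);
    [exact Hlt| |].
  - intros c Hc. unfold f'.
    apply (derivable_pt_lim_mult (own q i) L c).
    + apply own_price_derive; [assumption..|lra].
    + unfold L. apply is_derive_Reals. auto_derive; [trivial|]. field. lra.
  - assert (HL1 : L (q i) = 1) by (unfold L; field; lra).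
    assert (HL2 : L (q i * (1 - mu)) = 1 - E * mu) by (unfold L; field; lra).
    rewrite HL1, HL2 in Hc.
    enough (0 <= f' c) by nra.
    destruct (own_price_derive i q c Hi Hq) as (_ & Hown & Hneg & Hel); [lra|].
    unfold f'.
    (* Here [E >= 1] enters: [q i - E * (q i - c) <= c] for [c <= q i]. *)
    assert (HLc : L c * q i <= c).
    { unfold L. replace ((1 - E * (1 - c / q i)) * q i) with (q i - E * (q i - c)) by (field; lra). nra. }
    assert (- Derive (own q i) c * (L c * q i) <= - Derive (own q i) c * c)
      by (apply Rmult_le_compat_l; lra).
    apply (Rmult_le_reg_r (q i)); [exact Hqi|].
    replace ((Derive (own q i) c * L c + own q i c * (E / q i)) * q i)
      with (Derive (own q i) c * (L c * q i) + E * own q i c) by (field; lra).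
    lra.
Qed.

(** The market hypothesis moves one price at a time, so [mix k] switches the first [k] coordinates
    from [q] to [q']; at coordinate [i] nothing changes. *)
Lemma demand_gross_substitutes (i : nat) (q q' : nat -> R) :
  (i < n)%nat -> posvec n q -> q i = q' i ->
  (forall j, (j < n)%nat -> q j <= q' j) -> x i q <= x i q'.
Proof.
  intros Hi Hq Hii Hle.
  set (mix := fun k j => if Nat.ltb j k then q' j else q j).
  assert (Hmix : forall k, (k <= n)%nat -> x i q <= x i (mix k)).
  { induction k as [|k IH]; intros Hk.
    - apply Req_le, demand_ext. intros j _. reflexivity.
    - eapply Rle_trans; [apply IH; lia|].
      assert (Hpos : posvec n (mix k)).
      { intros j Hj. unfold mix. specialize (Hq j Hj). specialize (Hle j Hj).
        destruct (Nat.ltb j k); lra. }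
      destruct (Nat.eq_dec i k) as [e|ne].
      + apply Req_le, demand_ext. intros j _. unfold mix.
        destruct (Nat.ltb_spec j k), (Nat.ltb_spec j (S k)); try lia; try reflexivity.
        replace j with i by lia. exact Hii.
      + destruct Hdem as (_ & _ & _ & Hwgs & _).
        assert (Hk' : (k < n)%nat) by lia.
        specialize (Hwgs k i (mix k) (q k) (q' k) Hk' Hi ne Hpos (Hq k Hk') (Hle k Hk')).
        replace (x i (mix k)) with (x i (upd (mix k) k (q k))); [|apply demand_ext].
        replace (x i (mix (S k))) with (x i (upd (mix k) k (q' k))); [exact Hwgs|apply demand_ext].
        * intros j _. unfold upd, mix.
          destruct (Nat.eqb_spec j k), (Nat.ltb_spec j k), (Nat.ltb_spec j (S k)); try lia; congruence.
        * intros j _. unfold upd, mix.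
          destruct (Nat.eqb_spec j k), (Nat.ltb_spec j k); try lia; congruence. }
  eapply Rle_trans; [apply (Hmix n); lia|].
  apply Req_le, demand_ext. intros j Hj. unfold mix.
  destruct (Nat.ltb_spec j n); [reflexivity|lia].
Qed.

End Demand.

(** * Simultaneous price updates *)

Lemma capped_relative_excess (la g w : R) :
  0 < la -> 0 < w -> 0 <= g ->
  exists mu, la * med3 (-1) (g / w) 1 = mu /\ la * med3 (-1) (- g / w) 1 = - mu /\
    0 <= mu <= la /\ mu * w <= la * g /\ (mu = la \/ mu * w = la * g).
Proof.
  intros Hla Hw Hg.
  assert (Hz : g / w * w = g) by (field; lra).
  assert (Hz' : - g / w = - (g / w)) by (field; lra).
  assert (Hz0 : 0 <= g / w) by (apply Rdiv_le_0_compat; lra).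
  rewrite Hz'. set (z := g / w) in *. clearbody z. clear Hz'.
  (* One relative change serves both signs of the excess, since the median is odd here; the price
     steps use the median only through the resulting bounds on [mu]. *)
  exists (la * Rmin z 1).
  assert (e1 : med3 (-1) z 1 = Rmin z 1).
  { unfold med3, Rmax, Rmin; repeat destruct Rle_dec; lra. }
  assert (e2 : med3 (-1) (- z) 1 = - Rmin z 1).
  { unfold med3, Rmax, Rmin; repeat destruct Rle_dec; lra. }
  rewrite e1, e2, <- Hz.
  assert (Hm : 0 <= Rmin z 1 <= 1 /\ Rmin z 1 <= z /\ (Rmin z 1 = 1 \/ Rmin z 1 = z)).
  { unfold Rmin; destruct Rle_dec; lra. }
  destruct Hm as (Hm & Hmz & Hmm).
  set (r := Rmin z 1) in *.
  repeat split; [ring|nra|nra| |].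
  - rewrite Rmult_assoc. apply Rmult_le_compat_l; [lra|]. apply Rmult_le_compat_r; lra.
  - destruct Hmm as [-> | ->]; [left|right]; ring.
Qed.

(* Simultaneous updates are split into the price cuts, done first, and the price rises.  In the
   first phase every potential plus spending, in the second every potential minus spending,
   does not increase; total spending is fixed. *)
Lemma updates_decrease_potential (n : nat) (x : nat -> (nat -> R) -> R)
    (M E d la al1 al2 be : R) (U : nat -> bool) (p q y a w T : nat -> R) :
  market_demand n x M E -> 1 <= E -> 2 <= d -> 0 < la -> la * E < 1 ->
  0 < al1 -> 1 < al2 -> be = la * al1 -> be <= 1 / 2 ->
  al2 / 2 + al1 * Rmax (3 / 2) (d - 1) <= 1 ->
  la * al1 + 4 / 3 * la * (1 + 2 * E * d / (1 - la * E) + 1 / 2 * al2) <= 1 ->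
  posvec n p ->
  (forall j, (j < n)%nat ->
     0 < w j /\ 0 <= T j <= 1 /\ Rabs (a j - w j) <= w j / 3 /\
     x j p <= d * a j /\ 0 < y j /\
     q j = if U j then p j * (1 + la * med3 (-1) ((y j - a j) / w j) 1) else p j) ->
  rsum n (fun j => good_potential be al2 (q j) (x j q) (if U j then x j q else y j)
                     (a j) (w j) (if U j then 0 else T j))
  <= rsum n (fun j => good_potential be al2 (p j) (x j p) (y j) (a j) (w j) (T j)).
Proof.
  intros Hdem HE Hd Hla HlE Ha1 Ha2 Hbe Hbe2 H1 H3 Hp Hj.
  (* Goods to be cut; an updated good with [y j = a j] counts as a rise with [mu = 0]. *)
  set (D := fun j => andb (U j) (if Rlt_dec (y j) (a j) then true else false)).
  set (m := fun j => if D j then q j else p j).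
  assert (Hla1 : la < 1) by nra.
  set (K := 2 * E * d / (1 - la * E)) in *.
  (* Rises need the constant [2 * E * d] and cuts the larger [K]; the hypothesis stated with [K]
     therefore serves both. *)
  assert (HK : 2 * E * d <= K).
  { unfold K. apply (Rmult_le_reg_r (1 - la * E)); [lra|].
    replace (2 * E * d / (1 - la * E) * (1 - la * E)) with (2 * E * d) by (field; lra).
    assert (0 <= 2 * E * d * (la * E)) by (assert (0 <= E * d) by nra; assert (0 <= la * E) by nra; nra).
    lra. }
  assert (HK0 : 0 <= 2 * E * d) by nra.
  assert (H3a : be + 4 / 3 * la * (1 + 2 * E * d + 1 / 2 * al2) <= 1) by nra.
  assert (H3b : be + 4 / 3 * la * K <= 1) by nra.
  assert (Hcut : forall j, (j < n)%nat -> D j = true -> U j = true /\ y j < a j /\ exists mu,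
     q j = p j * (1 - mu) /\ 0 <= mu <= la /\ mu * w j <= la * (a j - y j) /\
     (mu = la \/ mu * w j = la * (a j - y j))).
  { intros j Hjn HD. unfold D in HD. apply andb_prop in HD as [HU HD].
    destruct (Rlt_dec (y j) (a j)) as [Hlt|]; [|discriminate].
    split; [exact HU|split; [exact Hlt|]].
    destruct (Hj j Hjn) as (Hw & _ & _ & _ & _ & Hq). rewrite HU in Hq.
    destruct (capped_relative_excess la (a j - y j) (w j)) as (mu & _ & e & Hmu); [lra..|].
    exists mu. split; [|exact Hmu].
    replace (y j - a j) with (- (a j - y j)) in Hq by ring. rewrite Hq, e; ring. }
  assert (Hrise : forall j, (j < n)%nat -> D j = false -> U j = true -> a j <= y j /\ exists mu,
     q j = p j * (1 + mu) /\ 0 <= mu <= la /\ mu * w j <= la * (y j - a j) /\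
     (mu = la \/ mu * w j = la * (y j - a j))).
  { intros j Hjn HD HU. unfold D in HD. rewrite HU in HD. simpl in HD.
    destruct (Rlt_dec (y j) (a j)) as [|Hge]; [discriminate|].
    split; [lra|].
    destruct (Hj j Hjn) as (Hw & _ & _ & _ & _ & Hq). rewrite HU in Hq.
    destruct (capped_relative_excess la (y j - a j) (w j)) as (mu & e & _ & Hmu); [lra..|].
    exists mu. split; [|exact Hmu]. now rewrite Hq, e. }
  assert (Hmp : forall j, (j < n)%nat -> 0 < m j <= p j).
  { intros j Hjn. unfold m. specialize (Hp j Hjn). destruct (D j) eqn:HD; [|lra].
    destruct (Hcut j Hjn HD) as (_ & _ & mu & e & Hmu & _). rewrite e. split; nra. }
  assert (Hmq : forall j, (j < n)%nat -> m j <= q j).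
  { intros j Hjn. unfold m. specialize (Hp j Hjn). destruct (D j) eqn:HD; [lra|].
    destruct (U j) eqn:HU.
    - destruct (Hrise j Hjn HD HU) as (_ & mu & e & Hmu & _). rewrite e. nra.
    - destruct (Hj j Hjn) as (_ & _ & _ & _ & _ & Hq). rewrite HU in Hq. lra. }
  assert (Hm : posvec n m) by (intros j Hjn; apply Hmp, Hjn).
  assert (Hq : posvec n q) by (intros j Hjn; specialize (Hm j Hjn); specialize (Hmq j Hjn); lra).
  set (mid := fun j => good_potential be al2 (m j) (x j m) (if D j then x j m else y j)
                     (a j) (w j) (if D j then 0 else T j)).
  assert (Hphase1 : rsum n (fun j => mid j + m j * x j m)
     <= rsum n (fun j => good_potential be al2 (p j) (x j p) (y j) (a j) (w j) (T j) + p j * x j p)).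
  { apply rsum_le. intros j Hjn. unfold mid.
    destruct (Hj j Hjn) as (Hw & HT & Haw & Hxd & Hy & _).
    assert (Hpj := Hp j Hjn).
    destruct (D j) eqn:HD.
    - destruct (Hcut j Hjn HD) as (HU & Hya & mu & e & Hmu & Hmw & Hcap).
      assert (em : m j = p j * (1 - mu)) by (unfold m; rewrite HD; exact e).
      rewrite em.
      apply (price_cut_step be al1 al2 la E d); auto; try lra.
      + eapply demand_pos; eassumption.
      + eapply demand_pos; eassumption.
      + assert (HEm : E * mu < 1) by nra.
        (* The own cut is applied alone; the remaining cuts only lower [x j], so the upper bound
           survives. *)
        eapply Rle_trans; [|apply (own_price_cut n x M E Hdem HE j p mu); auto; lra].
        apply Rmult_le_compat_r; [lra|].
        eapply (demand_gross_substitutes n x M E); eauto.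
        * rewrite upd_same; exact em.
        * intros k Hk. destruct (Nat.eq_dec k j) as [->|ne]; [rewrite upd_same; lra|].
          rewrite upd_other by exact ne. apply Hmp, Hk.
    - assert (em : m j = p j) by (unfold m; rewrite HD; reflexivity). rewrite em.
      assert (Hx : x j m <= x j p).
      { eapply (demand_gross_substitutes n x M E); eauto. intros k Hk; apply Hmp, Hk. }
      assert (HL := good_potential_lipschitz be al2 (p j) (x j p) (x j m) (y j) (a j) (w j) (T j)
                      (Rlt_le _ _ Hpj)).
      rewrite Rabs_left1 in HL by lra. lra. }
  assert (Hphase2 : rsum n (fun j => good_potential be al2 (q j) (x j q) (if U j then x j q else y j)
                     (a j) (w j) (if U j then 0 else T j) + (-1) * (q j * x j q))
     <= rsum n (fun j => mid j + (-1) * (m j * x j m))).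
  { apply rsum_le. intros j Hjn. unfold mid.
    destruct (Hj j Hjn) as (Hw & HT & Haw & Hxd & Hy & Hqj).
    assert (Hpj := Hp j Hjn). assert (Hmj := Hm j Hjn).
    destruct (D j) eqn:HD.
    - destruct (Hcut j Hjn HD) as (HU & _). rewrite HU.
      assert (em : m j = q j) by (unfold m; rewrite HD; reflexivity). rewrite em in *.
      assert (Hx : x j m <= x j q).
      { eapply (demand_gross_substitutes n x M E); eauto. }
      rewrite !good_potential_updated.
      assert (Rabs (x j q - a j) <= Rabs (x j m - a j) + (x j q - x j m)).
      { unfold Rabs; repeat destruct Rcase_abs; lra. }
      assert (q j * Rabs (x j q - a j) <= q j * (Rabs (x j m - a j) + (x j q - x j m)))
        by (apply Rmult_le_compat_l; lra).
      lra.
    - assert (em : m j = p j) by (unfold m; rewrite HD; reflexivity). rewrite em in *.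
      destruct (U j) eqn:HU.
      + destruct (Hrise j Hjn HD HU) as (Hya & mu & e & Hmu & Hmw & Hcap).
        assert (Hxmp : x j m <= x j p).
        { eapply (demand_gross_substitutes n x M E); eauto. intros k Hk; apply Hmp, Hk. }
        assert (G : good_potential be al2 (q j) (x j q) (x j q) (a j) (w j) 0 - q j * x j q
                  <= good_potential be al2 (p j) (x j m) (y j) (a j) (w j) (T j) - p j * x j m);
          [|lra].
        rewrite e.
        apply (price_rise_step be al1 al2 la E d); auto; try lra.
        * eapply demand_pos; eassumption.
        * eapply demand_pos; eassumption.
        (* The own rise is applied alone; the remaining rises only increase [x j], so the lower
           bound survives. *)
        * eapply Rle_trans; [apply (own_price_rise n x M E Hdem HE j m mu); auto; lra|].
          rewrite em.
          eapply (demand_gross_substitutes n x M E); eauto.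
          { apply posvec_upd; [exact Hm|]. apply Rmult_lt_0_compat; lra. }
          { rewrite upd_same; auto. }
          { intros k Hk. destruct (Nat.eq_dec k j) as [->|ne]; [rewrite upd_same; lra|].
            rewrite upd_other by exact ne. apply Hmq, Hk. }
      + rewrite Hqj.
        assert (Hx : x j m <= x j q).
        { eapply (demand_gross_substitutes n x M E); eauto. lra. }
        assert (HL := good_potential_lipschitz be al2 (p j) (x j m) (x j q) (y j) (a j) (w j) (T j)
                        (Rlt_le _ _ Hpj)).
        rewrite Rabs_pos_eq in HL by lra. lra. }
  rewrite !rsum_plus in Hphase1. rewrite !rsum_plus, !rsum_scal in Hphase2.
  destruct Hdem as (_ & _ & Hspend & _).
  rewrite (Hspend m Hm), (Hspend q Hq) in Hphase2.
  rewrite (Hspend m Hm), (Hspend p Hp) in Hphase1. lra.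
Qed.

(** * Continuity and update schedules *)

Lemma continuity_pt_Rabs_comp (f : R -> R) (z : R) :
  continuity_pt f z -> continuity_pt (fun h => Rabs (f h)) z.
Proof. intros Hf. apply (continuity_pt_comp f Rabs); [exact Hf|apply Rcontinuity_abs]. Qed.

Lemma continuity_pt_Rmax (f g : R -> R) (z : R) :
  continuity_pt f z -> continuity_pt g z -> continuity_pt (fun h => Rmax (f h) (g h)) z.
Proof.
  intros Hf Hg.
  apply continuity_pt_ext with (fun h => (f h + g h + Rabs (f h - g h)) * / 2).
  { intros h. unfold Rmax, Rabs; destruct Rle_dec, Rcase_abs; lra. }
  apply (continuity_pt_mult (fun h => f h + g h + Rabs (f h - g h)) (fun _ => / 2)).
  - apply (continuity_pt_plus (fun h => f h + g h) (fun h => Rabs (f h - g h))).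
    + now apply (continuity_pt_plus f g).
    + apply continuity_pt_Rabs_comp. now apply (continuity_pt_minus f g).
  - apply continuity_pt_const. intros ? ?; reflexivity.
Qed.

Lemma continuity_pt_Rmin (f g : R -> R) (z : R) :
  continuity_pt f z -> continuity_pt g z -> continuity_pt (fun h => Rmin (f h) (g h)) z.
Proof.
  intros Hf Hg.
  apply continuity_pt_ext with (fun h => - Rmax (- f h) (- g h)).
  { intros h. unfold Rmax, Rmin; repeat destruct Rle_dec; lra. }
  apply (continuity_pt_opp (fun h => Rmax (- f h) (- g h))).
  apply continuity_pt_Rmax; now apply continuity_pt_opp.
Qed.

Lemma good_potential_continuity (be al pr X W z : R) (Y A T : R -> R) :
  continuity_pt Y z -> continuity_pt A z -> continuity_pt T z ->
  continuity_pt (fun h => good_potential be al pr X (Y h) (A h) W (T h)) z.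
Proof.
  intros HY HA HT. unfold good_potential, span3.
  assert (Hc : forall c, continuity_pt (fun _ : R => c) z).
  { intros c. apply continuity_pt_const. intros ? ?; reflexivity. }
  assert (Hplus : forall f g, continuity_pt f z -> continuity_pt g z ->
                    continuity_pt (fun h => f h + g h) z) by exact (fun f g => continuity_pt_plus f g z).
  assert (Hopp : forall f, continuity_pt f z -> continuity_pt (fun h => - f h) z)
    by exact (fun f => continuity_pt_opp f z).
  assert (Hmult : forall f g, continuity_pt f z -> continuity_pt g z ->
                    continuity_pt (fun h => f h * g h) z) by exact (fun f g => continuity_pt_mult f g z).
  repeat first
    [ apply Hc | exact HY | exact HA | exact HT
    | apply continuity_pt_Rmax | apply continuity_pt_Rmin | apply continuity_pt_Rabs_comp
    | apply Hplus | apply Hopp | apply Hmult ].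
Qed.

Lemma rsum_continuity (n : nat) (f : nat -> R -> R) (z : R) :
  (forall i, (i < n)%nat -> continuity_pt (f i) z) ->
  continuity_pt (fun h => rsum n (fun i => f i h)) z.
Proof.
  induction n as [|n IH]; intros H; simpl.
  - apply continuity_pt_const. intros ? ?; reflexivity.
  - apply (continuity_pt_plus (fun h => rsum n (fun i => f i h)) (f n)).
    + apply IH. intros i Hi; apply H; lia.
    + apply H; lia.
Qed.

Lemma integ_RInt (f : R -> R) (a b : R) : ex_RInt f a b -> integ f a b = RInt f a b.
Proof.
  intros Hex. unfold integ.
  set (P := fun v => exists pr : Riemann_integrable f a b, RiemannInt pr = v).
  assert (HP : P (epsilon (inhabits 0) P)).
  { apply epsilon_spec. exists (RiemannInt (ex_RInt_Reals_0 f a b Hex)).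
    exists (ex_RInt_Reals_0 f a b Hex). reflexivity. }
  destruct HP as [pr Hpr]. rewrite <- Hpr. symmetry. apply RInt_Reals.
Qed.

Lemma le_of_small_slope (A B C del : R) :
  0 < del -> (forall h, 0 < h < del -> A <= B + C * h) -> A <= B.
Proof.
  intros Hdel H. apply Rle_plus_epsilon. intros eps Heps.
  assert (HC := Rle_abs C). assert (HC0 := Rabs_pos C).
  set (h := Rmin (del / 2) (eps / (Rabs C + 1))).
  assert (Hq : 0 < eps / (Rabs C + 1)) by (apply Rdiv_lt_0_compat; lra).
  assert (Hh : 0 < h) by (apply Rmin_glb_lt; lra).
  assert (h <= del / 2) by apply Rmin_l.
  assert (Hh2 : h <= eps / (Rabs C + 1)) by apply Rmin_r.
  apply (Rmult_le_compat_r (Rabs C + 1)) in Hh2; [|lra].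
  replace (eps / (Rabs C + 1) * (Rabs C + 1)) with eps in Hh2 by (field; lra).
  specialize (H h ltac:(lra)). nra.
Qed.

Lemma uniform_radius (n : nat) (P : nat -> R -> Prop) :
  (forall i d d', P i d -> 0 < d' <= d -> P i d') ->
  (forall i, (i < n)%nat -> exists d, 0 < d /\ P i d) ->
  exists d, 0 < d /\ forall i, (i < n)%nat -> P i d.
Proof.
  intros Hanti. induction n as [|n IH]; intros H.
  - exists 1; split; [lra|]. intros i Hi; lia.
  - destruct IH as (d1 & Hd1 & H1); [intros i Hi; apply H; lia|].
    destruct (H n) as (d2 & Hd2 & H2); [lia|].
    assert (Hl := Rmin_l d1 d2). assert (Hr := Rmin_r d1 d2).
    assert (Hm : 0 < Rmin d1 d2) by (apply Rmin_glb_lt; lra).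
    exists (Rmin d1 d2); split; [exact Hm|]. intros i Hi.
    destruct (Nat.eq_dec i n) as [->|ne].
    + apply (Hanti n d2); [exact H2|lra].
    + apply (Hanti i d1); [apply H1; lia|lra].
Qed.

Section Schedule.

Context (v : nat -> R) (Hv0 : v O = 0).
Context (Hv1 : forall k, v k < v (S k) /\ v (S k) <= v k + 1).
Context (Hv2 : forall T, exists k, T < v k).

Lemma schedule_lt (k l : nat) : (k < l)%nat -> v k < v l.
Proof.
  induction 1 as [|l Hl IH]; [apply Hv1|]. destruct (Hv1 l); lra.
Qed.

Lemma schedule_le (k l : nat) : (k <= l)%nat -> v k <= v l.
Proof.
  intros H. destruct (Nat.eq_dec k l) as [->|ne]; [lra|].
  apply Rlt_le, schedule_lt; lia.
Qed.

Lemma schedule_nonneg (k : nat) : 0 <= v k.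
Proof. rewrite <- Hv0. apply schedule_le; lia. Qed.

Lemma schedule_locate (t : R) : 0 <= t -> exists k, v k <= t < v (S k).
Proof.
  intros Ht. destruct (Hv2 t) as [K HK].
  induction K as [|K IH]; [lra|].
  destruct (Rlt_dec t (v K)); [now apply IH|]. exists K; lra.
Qed.

Lemma schedule_locate_left (t : R) : 0 < t -> exists k, v k < t <= v (S k).
Proof.
  intros Ht. destruct (schedule_locate t) as [k Hk]; [lra|].
  destruct (Req_dec_T (v k) t) as [e|ne].
  - destruct k as [|k]; [lra|]. exists k. destruct (Hv1 k); lra.
  - exists k; lra.
Qed.

Lemma last_update_eq (k : nat) (t : R) : v k <= t < v (S k) -> last_update v t = v k.
Proof.
  intros Hk. unfold last_update.
  set (P := fun r => exists k, v k <= t < v (S k) /\ r = v k).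
  assert (HP : P (epsilon (inhabits 0) P)).
  { apply epsilon_spec. exists (v k), k. split; [exact Hk|reflexivity]. }
  destruct HP as (l & Hl & ->).
  destruct (Nat.lt_trichotomy k l) as [H|[->|H]]; [|reflexivity|].
  - assert (Hle := schedule_le (S k) l H). lra.
  - assert (Hle := schedule_le (S l) k H). lra.
Qed.

End Schedule.

(** * The market dynamics *)

Section Dynamics.

Context (n : nat) (w : nat -> R) (x : nat -> (nat -> R) -> R) (M E d : R)
  (p : nat -> R -> R) (u : nat -> nat -> R) (s0 sstar : nat -> R)
  (kappa lambda alpha1 alpha2 : R).
Context (Hw : forall i, (i < n)%nat -> 0 < w i).
Context (Hdem : market_demand n x M E) (HE : 1 <= E).
Context (Hkappa : 0 < kappa) (Hlambda : 0 < lambda) (Halpha1 : 0 < alpha1).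
Context (Hp0 : forall i, (i < n)%nat -> 0 < p i 0) (Hsched : update_schedule n u).
Context (Hconst : forall i k t, (i < n)%nat -> u i k <= t < u i (S k) -> p i t = p i (u i k)).

Let dem (i : nat) (t : R) : R := demand_at x p i t.
Let wt (i : nat) (t : R) : R := tw w x p s0 sstar kappa i t.
Let xb (i : nat) (t : R) : R := xbar x p u i t.

Context (Hupd : forall i k, (i < n)%nat ->
      p i (u i (S k)) =
      p i (u i k) *
        (1 + lambda *
             med3 (-1)
               ((integ (fun r => dem i r) (u i k) (u i (S k)) / (u i (S k) - u i k)
                 - wt i (u i (S k))) / w i)
               1)).
Context (Hbounds : forall i t, (i < n)%nat -> 0 <= t ->
      Rabs (wt i t - w i) <= w i / 3 /\ dem i t <= d * wt i t).
Context (Hd : 2 <= d) (Halpha2 : 1 < alpha2 < 2).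
Context (H1 : alpha2 / 2 + alpha1 * Rmax (3 / 2) (d - 1) <= 1) (H2 : lambda * E < 1).
Context (H3 : lambda * alpha1 + 4 / 3 * lambda * (1 + 2 * E * d / (1 - lambda * E) + 1 / 2 * alpha2) <= 1).
Context (H4 : 4 * kappa * (1 + alpha2) <= lambda * alpha1 /\ lambda * alpha1 <= 1 / 2).

Let potential (t : R) : R := phi n w x p u s0 sstar kappa lambda alpha1 alpha2 t.

(** No good updates strictly between [a] and [b], while both ends may be update times. Thus one
    notion describes the time just after [t] and the time just before [t]. *)
Definition quiet (a b : R) : Prop :=
  forall i, (i < n)%nat -> exists k, u i k <= a /\ b <= u i (S k).

Lemma quiet_right (t : R) : 0 <= t -> exists del, 0 < del /\ quiet t (t + del).
Proof.
  intros Ht.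
  apply (uniform_radius n (fun i del => exists k, u i k <= t /\ t + del <= u i (S k))).
  - intros i a b (k & Hk) Hb. exists k; lra.
  - intros i Hi. destruct (Hsched i Hi) as (Hu0 & Hu1 & Hu2).
    destruct (schedule_locate (u i) Hu0 Hu2 t Ht) as [k Hk].
    exists (u i (S k) - t); split; [lra|]. exists k; lra.
Qed.

Lemma quiet_left (t : R) : 0 < t -> exists del, 0 < del <= t /\ quiet (t - del) t.
Proof.
  intros Ht.
  destruct (uniform_radius n (fun i del => exists k, u i k <= t - del /\ t <= u i (S k)))
    as (del & Hdel & H).
  - intros i a b (k & Hk) Hb. exists k; lra.
  - intros i Hi. destruct (Hsched i Hi) as (Hu0 & Hu1 & Hu2).
    destruct (schedule_locate_left (u i) Hu0 Hu1 Hu2 t Ht) as [k Hk].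
    exists (t - u i k); split; [lra|]. exists k; lra.
  - assert (Hl := Rmin_l del t). assert (Hr := Rmin_r del t).
    assert (Hm : 0 < Rmin del t) by (apply Rmin_glb_lt; lra).
    exists (Rmin del t); split; [lra|]. intros i Hi. destruct (H i Hi) as (k & Hk). exists k; lra.
Qed.

Lemma quiet_price (a b r : R) (i : nat) :
  (i < n)%nat -> quiet a b -> a <= r < b -> p i r = p i a.
Proof.
  intros Hi Hq Hr. destruct (Hq i Hi) as (k & Hk).
  rewrite (Hconst i k r Hi), (Hconst i k a Hi); lra.
Qed.

Lemma quiet_tau (a b r : R) (i : nat) :
  (i < n)%nat -> quiet a b -> a <= r < b -> tau u i r = tau u i a.
Proof.
  intros Hi Hq Hr. destruct (Hq i Hi) as (k & Hk).
  destruct (Hsched i Hi) as (_ & Hu1 & _). unfold tau.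
  rewrite !(last_update_eq (u i) Hu1 k) by lra. reflexivity.
Qed.

Lemma quiet_demand (a b r : R) (i : nat) :
  quiet a b -> a <= r < b -> dem i r = dem i a.
Proof.
  intros Hq Hr. unfold dem, demand_at. apply (demand_ext n x M E Hdem).
  intros j Hj. unfold pv. now apply (quiet_price a b).
Qed.

Lemma quiet_is_RInt (a b c e : R) (i : nat) :
  quiet a b -> a <= c -> c <= e -> e <= b -> is_RInt (dem i) c e ((e - c) * dem i a).
Proof.
  intros Hq Hac Hce Heb.
  apply is_RInt_ext with (fun _ => dem i a).
  - rewrite Rmin_left, Rmax_right by lra. intros r Hr. symmetry.
    apply (quiet_demand a b); [exact Hq|lra].
  - apply (is_RInt_const c e (dem i a)).
Qed.

Lemma demand_ex_RInt (i : nat) (a b : R) : 0 <= a -> a <= b -> ex_RInt (dem i) a b.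
Proof.
  intros Ha Hab.
  assert (H0 : forall c, 0 <= c -> ex_RInt (dem i) 0 c).
  { intros c Hc. apply (real_induction (fun c => ex_RInt (dem i) 0 c) 0 c Hc).
    - apply ex_RInt_point.
    - intros t Ht Hex. destruct (quiet_right t) as (del & Hdel & Hq); [lra|].
      exists del; split; [exact Hdel|]. intros r Hr _.
      apply ex_RInt_Chasles with t; [exact Hex|].
      eexists; apply (quiet_is_RInt t (t + del)); [exact Hq|lra..].
    - intros t Ht Hex. destruct (quiet_left t) as (del & Hdel & Hq); [lra|].
      apply ex_RInt_Chasles with (t - del); [apply Hex; lra|].
      eexists; apply (quiet_is_RInt (t - del) t); [exact Hq|lra..]. }
  apply ex_RInt_Chasles with 0; [apply ex_RInt_swap|]; apply H0; lra.
Qed.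

(** Stocks, averages and left limits are all rewritten through this one function, affine in time on
    quiet intervals. *)
Let cum (i : nat) (t : R) : R := RInt (dem i) 0 t.

Lemma integ_demand (i : nat) (a b : R) :
  0 <= a -> a <= b -> integ (fun r => dem i r) a b = cum i b - cum i a.
Proof.
  intros Ha Hab.
  assert (Hc := RInt_Chasles (dem i) 0 a b (demand_ex_RInt i 0 a ltac:(lra) Ha)
                  (demand_ex_RInt i a b Ha Hab)).
  transitivity (RInt (dem i) a b); [apply integ_RInt, demand_ex_RInt; assumption|].
  unfold plus in Hc; simpl in Hc. unfold cum. lra.
Qed.

Lemma quiet_cum (a b c e : R) (i : nat) :
  quiet a b -> 0 <= a -> a <= c -> c <= e -> e <= b ->
  cum i e = cum i c + (e - c) * dem i a.
Proof.
  intros Hq Ha Hac Hce Heb.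
  assert (Hc := RInt_Chasles (dem i) 0 c e (demand_ex_RInt i 0 c ltac:(lra) ltac:(lra))
                  (demand_ex_RInt i c e ltac:(lra) Hce)).
  rewrite (is_RInt_unique _ _ _ _ (quiet_is_RInt a b c e i Hq Hac Hce Heb)) in Hc.
  unfold plus in Hc; simpl in Hc. unfold cum. lra.
Qed.

Lemma wt_cum (i : nat) (t : R) :
  0 <= t -> wt i t = w i + kappa * (s0 i + (w i * t - cum i t) - sstar i).
Proof.
  intros Ht. unfold wt, tw, stock.
  assert (Hex := demand_ex_RInt i 0 t ltac:(lra) Ht).
  assert (Hexc : ex_RInt (fun _ : R => w i) 0 t) by apply ex_RInt_const.
  rewrite integ_RInt.
  - assert (Hm := RInt_minus (fun _ => w i) (dem i) 0 t Hexc Hex).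
    rewrite RInt_const in Hm. unfold minus, plus, opp, scal in Hm; simpl in Hm.
    unfold mult in Hm; simpl in Hm.
    transitivity (w i + kappa * (s0 i + ((t - 0) * w i + - cum i t) - sstar i)); [|ring].
    unfold cum. rewrite <- Hm. reflexivity.
  - exact (ex_RInt_minus (fun _ => w i) (dem i) 0 t Hexc Hex).
Qed.

Lemma quiet_wt (a b c e : R) (i : nat) :
  quiet a b -> 0 <= a -> a <= c -> c <= e -> e <= b ->
  wt i e = wt i c + kappa * (e - c) * (w i - dem i a).
Proof.
  intros Hq Ha Hac Hce Heb. rewrite !wt_cum by lra.
  rewrite (quiet_cum a b c e) by assumption. ring.
Qed.

Lemma tau_bounds (i : nat) (t : R) :
  (i < n)%nat -> 0 <= t -> 0 <= tau u i t <= t /\ t - tau u i t <= 1.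
Proof.
  intros Hi Ht. destruct (Hsched i Hi) as (Hu0 & Hu1 & Hu2).
  destruct (schedule_locate (u i) Hu0 Hu2 t Ht) as [k Hk].
  unfold tau. rewrite (last_update_eq (u i) Hu1 k) by exact Hk.
  assert (H0 := schedule_nonneg (u i) Hu0 Hu1 k). destruct (Hu1 k). lra.
Qed.

Lemma xb_cum (i : nat) (t : R) :
  0 <= tau u i t < t -> xb i t = (cum i t - cum i (tau u i t)) / (t - tau u i t).
Proof.
  intros Ht. unfold xb, xbar. destruct (Req_dec_T t (tau u i t)) as [e|ne]; [lra|].
  fold (dem i). now rewrite integ_demand by lra.
Qed.

Lemma xb_at_update (i : nat) (t : R) : tau u i t = t -> xb i t = dem i t.
Proof. intros e. unfold xb, xbar. destruct (Req_dec_T t (tau u i t)); [reflexivity|congruence]. Qed.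

Lemma quiet_xb (t b h : R) (i : nat) :
  (i < n)%nat -> 0 <= t -> quiet t b -> 0 < h < b - t ->
  (t - tau u i t + h) * xb i (t + h) = (t - tau u i t) * xb i t + h * dem i t.
Proof.
  intros Hi Ht Hq Hh.
  destruct (tau_bounds i t Hi Ht) as (Htau & _).
  assert (e : tau u i (t + h) = tau u i t) by (apply (quiet_tau t b); [assumption..|lra]).
  rewrite (xb_cum i (t + h)) by (rewrite e; lra). rewrite e.
  rewrite (quiet_cum t b t (t + h)) by (assumption || lra).
  destruct (Req_dec_T (tau u i t) t) as [e'|ne].
  - rewrite (xb_at_update i t e'), e'. field. lra.
  - rewrite (xb_cum i t) by lra. field. lra.
Qed.

Lemma price_pos (i : nat) (t : R) : (i < n)%nat -> 0 <= t -> 0 < p i t.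
Proof.
  intros Hi Ht. destruct (Hsched i Hi) as (Hu0 & Hu1 & Hu2).
  (* From [lambda * E < 1] and [E >= 1]; every update factor is then at least [1 - lambda > 0]. *)
  assert (Hla : lambda < 1) by nra.
  assert (H : forall k, 0 < p i (u i k)).
  { induction k as [|k IH]; [rewrite Hu0; now apply Hp0|].
    rewrite Hupd by exact Hi. apply Rmult_lt_0_compat; [exact IH|].
    set (z := _ / w i).
    assert (-1 <= med3 (-1) z 1) by (unfold med3, Rmax, Rmin; repeat destruct Rle_dec; lra).
    nra. }
  destruct (schedule_locate (u i) Hu0 Hu2 t Ht) as [k Hk].
  rewrite (Hconst i k t Hi Hk). apply H.
Qed.

Lemma posvec_price (t : R) : 0 <= t -> posvec n (pv p t).
Proof. intros Ht j Hj. now apply price_pos. Qed.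

(** * Slopes and left limits of the total potential *)

Let gap (i : nat) (t : R) : R := span3 (dem i t) (xb i t) (wt i t).

Let term (i : nat) (t : R) : R :=
  good_potential (lambda * alpha1) alpha2 (p i t) (dem i t) (xb i t) (wt i t) (w i)
    (t - tau u i t).

Lemma potential_right_slope (t : R) :
  0 <= t ->
  right_slope_le (fun h => potential (t + h)) (potential t)
    (rsum n (fun i => - p i t *
       Rmax (kappa * (alpha2 - 1) / 2 * (gap i t + alpha2 * Rabs (wt i t - w i)))
            (3 / 4 * (lambda * alpha1) * gap i t))).
Proof.
  intros Ht. destruct (quiet_right t Ht) as (del & Hdel & Hq).
  apply (right_slope_le_rsum n (fun i h => term i (t + h)) (fun i => term i t)).
  intros i Hi. destruct (tau_bounds i t Hi Ht) as (Htau & HT).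
  (* With a single branch the maximum lemma just replaces the function by one that agrees with it on
     [(0, del)], where price, demand and last update time are frozen. *)
  apply (right_slope_le_finite_max unit (tt :: nil)%list
    (fun _ h => good_potential (lambda * alpha1) alpha2 (p i t) (dem i t)
                  (xb i (t + h)) (wt i (t + h)) (w i) (t - tau u i t + h)) _ _ _ del Hdel).
  - intros _ _. destruct H4 as [H4a H4b].
    apply (good_potential_right_slope kappa (lambda * alpha1) alpha2 (p i t) (dem i t) (xb i t)
             (wt i t) (w i) (t - tau u i t) del); try assumption; try lra.
    + intros e. apply xb_at_update. lra.
    + now apply price_pos.
    + intros h Hh. apply (quiet_xb t (t + del)); try assumption. lra.
    + intros h Hh. rewrite (quiet_wt t (t + del) t (t + h)) by (assumption || lra).
      replace (t + h - t) with h by ring. reflexivity.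
  - intros h Hh. exists tt; split; [left; reflexivity|]. apply Req_le. unfold term.
    rewrite (quiet_price t (t + del) (t + h) i Hi Hq), (quiet_demand t (t + del) (t + h) i Hq),
      (quiet_tau t (t + del) (t + h) i Hi Hq) by lra.
    f_equal; ring.
Qed.


(** The hypothesis at [t] itself concerns the demand after an update. The demand before it is
    bounded by letting [h] tend to [0] in the bound at [t - h], where demand is constant and the
    target affine. *)
Lemma left_demand_bound (a t : R) (i : nat) :
  (i < n)%nat -> 0 <= a < t -> quiet a t -> dem i a <= d * wt i t.
Proof.
  intros Hi Hat Hq.
  apply (le_of_small_slope _ _ (- (d * (kappa * (w i - dem i a)))) (t - a)); [lra|].
  intros h Hh. destruct (Hbounds i (t - h) Hi) as [_ Hb]; [lra|].
  rewrite (quiet_demand a t (t - h)) in Hb by (assumption || lra).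
  rewrite (quiet_wt a t (t - h) t) by (assumption || lra). lra.
Qed.

(** Provides the positive average that a price cut requires; the quiet interval makes the inequality
    strict. *)
Lemma cum_increasing (a b c : R) (i : nat) :
  (i < n)%nat -> 0 <= a -> a <= b -> b < c -> quiet b c -> cum i a < cum i c.
Proof.
  intros Hi Ha Hab Hbc Hq.
  rewrite (quiet_cum b c b c i Hq) by lra.
  assert (Hx : 0 < dem i b).
  { apply (demand_pos n x M E Hdem); [exact Hi|]. apply posvec_price; lra. }
  assert (cum i a <= cum i b); [|nra].
  enough (0 <= cum i b - cum i a) by lra.
  rewrite <- integ_demand, integ_RInt by (try apply demand_ex_RInt; lra).
  apply RInt_ge_0; [exact Hab|apply demand_ex_RInt; lra|].
  intros r Hr. apply Rlt_le, (demand_pos n x M E Hdem); [exact Hi|]. apply posvec_price; lra.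
Qed.

(* Left limit at [t] of the running average [xb i], when [quiet a t]. *)
Let left_average (i : nat) (a t : R) : R := (cum i t - cum i (tau u i a)) / (t - tau u i a).

Lemma potential_left_limit (a t : R) :
  0 <= a < t -> quiet a t ->
  forall eps, 0 < eps -> exists del, 0 < del /\ forall r, t - del < r < t ->
    rsum n (fun i => good_potential (lambda * alpha1) alpha2 (p i a) (dem i a)
                       (left_average i a t) (wt i t) (w i) (t - tau u i a))
    <= potential r + eps.
Proof.
  intros Hat Hq eps Heps.
  set (F := fun i h => good_potential (lambda * alpha1) alpha2 (p i a) (dem i a)
     ((cum i t - h * dem i a - cum i (tau u i a)) / (t - h - tau u i a))
     (wt i t - kappa * h * (w i - dem i a)) (w i) (t - h - tau u i a)).
  assert (HF : continuity_pt (fun h => rsum n (fun i => F i h)) 0).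
  { apply rsum_continuity. intros i Hi. destruct (tau_bounds i a Hi ltac:(lra)) as (Htau & _).
    unfold F.
    apply (good_potential_continuity _ _ _ _ _ 0
             (fun h => (cum i t - h * dem i a - cum i (tau u i a)) / (t - h - tau u i a))
             (fun h => wt i t - kappa * h * (w i - dem i a)) (fun h => t - h - tau u i a));
      apply derivable_continuous_pt, ex_derive_Reals_0; auto_derive; trivial; lra. }
  destruct (proj1 (continuity_pt_locally (fun h => rsum n (fun i => F i h)) 0) HF
              (mkposreal eps Heps)) as [del Hdel]; simpl in Hdel.
  assert (Hm1 := Rmin_l del (t - a)). assert (Hm2 := Rmin_r del (t - a)).
  assert (Hdp := cond_pos del).
  exists (Rmin del (t - a)). split; [apply Rmin_glb_lt; lra|]. intros r Hr.
  specialize (Hdel (t - r)).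
  assert (Hball : ball 0 del (t - r)).
  { unfold ball; simpl; unfold AbsRing_ball, abs, minus, plus, opp; simpl.
    rewrite Rabs_pos_eq; lra. }
  specialize (Hdel Hball). apply Rabs_lt_between in Hdel.
  assert (e0 : rsum n (fun i => good_potential (lambda * alpha1) alpha2 (p i a) (dem i a)
                       (left_average i a t) (wt i t) (w i) (t - tau u i a))
               = rsum n (fun i => F i 0)).
  { apply rsum_ext. intros i Hi. unfold F, left_average. f_equal; [f_equal| |]; try ring. }
  assert (er : potential r = rsum n (fun i => F i (t - r))).
  { apply rsum_ext. intros i Hi. change (term i r = F i (t - r)). unfold term, F.
    destruct (tau_bounds i a Hi ltac:(lra)) as (Htau & _).
    assert (et : tau u i r = tau u i a) by (apply (quiet_tau a t); [assumption..|lra]).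
    rewrite (xb_cum i r) by (rewrite et; lra). rewrite et.
    rewrite (quiet_price a t r i Hi Hq), (quiet_demand a t r i Hq) by lra.
    rewrite (quiet_wt a t r t i Hq), (quiet_cum a t r t i Hq) by lra.
    replace (t - (t - r)) with r by ring.
    f_equal; [f_equal|]; ring. }
  rewrite e0, er. lra.
Qed.

Lemma potential_left (t : R) :
  0 < t -> forall eps, 0 < eps ->
  exists del, 0 < del /\ forall r, t - del < r < t -> potential t <= potential r + eps.
Proof.
  intros Ht eps Heps. destruct (quiet_left t Ht) as (del0 & Hdel0 & Hq).
  set (a := t - del0) in *. assert (Hat : 0 <= a < t) by (unfold a; lra).
  destruct (potential_left_limit a t Hat Hq eps Heps) as (del & Hdel & Hlim).
  exists del; split; [exact Hdel|]. intros r Hr. eapply Rle_trans; [|apply Hlim, Hr].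
  set (U := fun i => if Req_dec_T (tau u i t) t then true else false).
  assert (HU : forall i, (i < n)%nat ->
    (U i = true /\ tau u i t = t /\
       p i t = p i a * (1 + lambda * med3 (-1) ((left_average i a t - wt i t) / w i) 1)) \/
    (U i = false /\ tau u i t = tau u i a /\ p i t = p i a)).
  { intros i Hi. destruct (Hq i Hi) as (k & Hk).
    destruct (Hsched i Hi) as (Hu0 & Hu1 & _).
    assert (ea : tau u i a = u i k) by (apply (last_update_eq (u i) Hu1 k); lra).
    assert (epa : p i a = p i (u i k)) by (apply Hconst; [exact Hi|lra]).
    assert (Hk0 := schedule_nonneg (u i) Hu0 Hu1 k).
    unfold U. destruct (Req_dec_T t (u i (S k))) as [e|ne].
    - left. assert (et : tau u i t = t).
      { rewrite e. apply (last_update_eq (u i) Hu1 (S k)). destruct (Hu1 (S k)); lra. }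
      destruct (Req_dec_T (tau u i t) t) as [_|ne]; [|contradiction].
      split; [reflexivity|split; [exact et|]].
      rewrite epa, e, Hupd by exact Hi. rewrite integ_demand by lra.
      unfold left_average. rewrite ea. reflexivity.
    - right. assert (et : tau u i t = u i k) by (apply (last_update_eq (u i) Hu1 k); lra).
      destruct (Req_dec_T (tau u i t) t) as [e'|_]; [lra|].
      split; [reflexivity|split; [congruence|]].
      rewrite epa. apply Hconst; [exact Hi|lra]. }
  assert (Hexp : potential t = rsum n (fun i => good_potential (lambda * alpha1) alpha2 (p i t)
      (x i (pv p t)) (if U i then x i (pv p t) else left_average i a t) (wt i t) (w i)
      (if U i then 0 else t - tau u i a))).
  { apply rsum_ext. intros i Hi. change (term i t = good_potential (lambda * alpha1) alpha2 (p i t)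
      (dem i t) (if U i then dem i t else left_average i a t) (wt i t) (w i)
      (if U i then 0 else t - tau u i a)).
    unfold term. destruct (HU i Hi) as [(-> & et & _)|(-> & et & _)].
    - rewrite (xb_at_update i t et), et. f_equal; ring.
    - destruct (tau_bounds i a Hi ltac:(lra)) as (Htau & _).
      rewrite (xb_cum i t) by (rewrite et; lra). rewrite et. reflexivity. }
  rewrite Hexp.
  apply (updates_decrease_potential n x M E d lambda alpha1 alpha2 (lambda * alpha1) U
           (pv p a) (pv p t) (fun i => left_average i a t) (fun i => wt i t) w
           (fun i => t - tau u i a)); try assumption; try apply H4; try apply Halpha2; try reflexivity.
  { apply posvec_price; lra. }
  intros i Hi. destruct (tau_bounds i a Hi ltac:(lra)) as (Htau & _).
  destruct (Hbounds i t Hi ltac:(lra)) as [Hb _].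
  repeat split; auto; try lra.
  - destruct (Hq i Hi) as (k & Hk). destruct (Hsched i Hi) as (_ & Hu1 & _).
    unfold tau. rewrite (last_update_eq (u i) Hu1 k) by lra. destruct (Hu1 k); lra.
  - apply (left_demand_bound a t i Hi Hat Hq).
  - apply Rdiv_lt_0_compat; [|lra].
    assert (Hc := cum_increasing (tau u i a) a t i Hi (proj1 Htau) (proj2 Htau) (proj2 Hat) Hq). lra.
  - destruct (HU i Hi) as [(-> & _ & e)|(-> & _ & e)]; exact e.
Qed.

(** * Decay over one day *)

Lemma term_bounds (i : nat) (t : R) :
  (i < n)%nat -> 0 <= t ->
  0 <= term i t <= p i t * (gap i t + alpha2 * Rabs (wt i t - w i)) /\
  0 <= gap i t /\ 0 < p i t.
Proof.
  intros Hi Ht. assert (Hp := price_pos i t Hi Ht).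
  destruct (tau_bounds i t Hi Ht) as (Htau & HT). destruct H4 as [_ H4b].
  unfold term, good_potential. fold (gap i t).
  assert (Hg : Rabs (xb i t - wt i t) <= gap i t).
  { assert (Hs := span3_bounds (dem i t) (xb i t) (wt i t)). unfold gap.
    unfold Rabs; destruct Rcase_abs; lra. }
  assert (HR := Rabs_pos (xb i t - wt i t)). assert (HR' := Rabs_pos (wt i t - w i)).
  set (T := t - tau u i t) in *. set (be := lambda * alpha1) in *.
  assert (Hbe : 0 < be) by (unfold be; nra).
  (* Hence the discount takes away at most half of the span, and the term stays nonnegative. *)
  assert (HbT : 0 <= be * T <= 1 / 2) by (split; unfold T in *; nra).
  assert (0 <= be * T * Rabs (xb i t - wt i t) <= 1 / 2 * Rabs (xb i t - wt i t)) by (split; nra).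
  assert (0 <= alpha2 * Rabs (wt i t - w i)) by nra.
  repeat split; try lra.
  - apply Rmult_le_pos; lra.
  - apply Rmult_le_compat_l; lra.
Qed.

Lemma potential_nonneg (t : R) : 0 <= t -> 0 <= potential t.
Proof.
  intros Ht. replace 0 with (rsum n (fun _ => 0 * 0)) by (rewrite rsum_scal; ring).
  apply rsum_le. intros i Hi. rewrite Rmult_0_l. apply (term_bounds i t Hi Ht).
Qed.

Lemma potential_decay (t : R) :
  0 <= t -> kappa * (alpha2 - 1) / 2 <= 1 ->
  potential (t + 1) <= (1 - kappa * (alpha2 - 1) / 4) * potential t.
Proof.
  intros Ht H5.
  replace (kappa * (alpha2 - 1) / 4) with (kappa * (alpha2 - 1) / 2 / 2) by field.
  apply unit_time_decay; [split; nra|now apply potential_nonneg| |].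
  - intros s Hs. eapply right_slope_le_weaken; [|apply potential_right_slope; lra].
    change (potential s) with (rsum n (fun i => term i s)). rewrite <- rsum_scal.
    apply rsum_le. intros i Hi. destruct (term_bounds i s Hi ltac:(lra)) as ((_ & Hle) & _ & Hp).
    set (rho := kappa * (alpha2 - 1) / 2).
    assert (Hrho : 0 <= rho) by (unfold rho; nra).
    assert (Hm := Rmax_l (rho * (gap i s + alpha2 * Rabs (wt i s - w i)))
                         (3 / 4 * (lambda * alpha1) * gap i s)).
    apply (Rmult_le_compat_l (p i s)) in Hm; [|lra].
    apply (Rmult_le_compat_l rho) in Hle; [|lra]. lra.
  - intros s Hs. apply potential_left; lra.
Qed.

Lemma potential_fast_decay (t : R) :
  0 <= t ->
  (forall r, t <= r <= t + 1 ->
     2 * (1 + 2 * alpha2) * rsum n (fun i => Rabs (wt i r - w i) * p i r) <= potential r) ->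
  potential (t + 1) <= (1 - lambda * alpha1 / (8 * (1 + alpha2))) * potential t.
Proof.
  intros Ht Hfar. destruct H4 as [_ H4b].
  set (be := lambda * alpha1) in *. assert (Hbe : 0 < be) by (unfold be; nra).
  replace (be / (8 * (1 + alpha2))) with (be / (4 * (1 + alpha2)) / 2) by (field; lra).
  assert (Hrho : 0 <= be / (4 * (1 + alpha2)) <= be / 8).
  { split; [apply Rdiv_le_0_compat; lra|].
    apply Rmult_le_compat_l; [lra|]. apply Rinv_le_contravar; lra. }
  apply unit_time_decay; [lra|now apply potential_nonneg| |].
  - intros s Hs. eapply right_slope_le_weaken; [|apply potential_right_slope; lra].
    assert (Hpos := potential_nonneg s ltac:(lra)).
    specialize (Hfar s ltac:(lra)).
    set (W := rsum n (fun i => Rabs (wt i s - w i) * p i s)) in *.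
    assert (HW : 0 <= W).
    { replace 0 with (rsum n (fun _ => 0 * 0)) by (rewrite rsum_scal; ring).
      apply rsum_le. intros i Hi. rewrite Rmult_0_l.
      apply Rmult_le_pos; [apply Rabs_pos|apply Rlt_le, price_pos; [exact Hi|lra]]. }
    set (G := rsum n (fun i => p i s * gap i s)).
    assert (HG : potential s <= G + alpha2 * W).
    { unfold G, W. rewrite <- rsum_scal, <- rsum_plus. apply rsum_le. intros i Hi.
      destruct (term_bounds i s Hi ltac:(lra)) as ((_ & Hle) & _). fold (term i s).
      eapply Rle_trans; [exact Hle|]. lra. }
    eapply Rle_trans with (- (3 / 4 * be) * G).
    + unfold G. rewrite <- rsum_scal. apply rsum_le. intros i Hi.
      destruct (term_bounds i s Hi ltac:(lra)) as (_ & _ & Hp).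
      assert (Hm := Rmax_r (kappa * (alpha2 - 1) / 2 * (gap i s + alpha2 * Rabs (wt i s - w i)))
                           (3 / 4 * be * gap i s)).
      apply (Rmult_le_compat_l (p i s)) in Hm; [|lra]. fold be. lra.
    (* The hypothesis gives [alpha2 * W <= potential s / 4]. The slope is then at most
       [- 9 / 16 * be * potential s], well below the required [- be / 8 * potential s]. *)
    + assert (HG2 : 3 / 4 * potential s <= G) by lra.
      apply (Rmult_le_compat_l (3 / 4 * be)) in HG2; [|lra].
      assert (be / (4 * (1 + alpha2)) * potential s <= be / 8 * potential s)
        by (apply Rmult_le_compat_r; lra).
      assert (0 <= be * potential s) by nra. lra.
  - intros s Hs. apply potential_left; lra.
Qed.

End Dynamics.

Theorem mainTheorem11
  (n : nat) (w : nat -> R) (x : nat -> (nat -> R) -> R) (M E d : R)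
  (p : nat -> R -> R) (u : nat -> nat -> R) (s0 sstar : nat -> R)
  (kappa lambda alpha1 alpha2 : R)
  (Hw : forall i, (i < n)%nat -> 0 < w i)
  (HM : 0 < M)
  (Hdem : market_demand n x M E)
  (HE : 1 <= E)
  (Hkappa : 0 < kappa) (Hlambda : 0 < lambda) (Halpha1 : 0 < alpha1)
  (Hp0 : forall i, (i < n)%nat -> 0 < p i 0)
  (Hsched : update_schedule n u)
  (Hconst : forall i k t, (i < n)%nat -> u i k <= t < u i (S k) -> p i t = p i (u i k))
  (Hupd : forall i k, (i < n)%nat ->
      p i (u i (S k)) =
      p i (u i k) *
        (1 + lambda *
             med3 (-1)
               ((integ (fun r => demand_at x p i r) (u i k) (u i (S k)) / (u i (S k) - u i k)
                 - tw w x p s0 sstar kappa i (u i (S k))) / w i)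
               1))
  (Hbounds : forall i t, (i < n)%nat -> 0 <= t ->
      Rabs (tw w x p s0 sstar kappa i t - w i) <= w i / 3 /\
      demand_at x p i t <= d * tw w x p s0 sstar kappa i t)
  (Hd : 2 <= d)
  (Halpha2 : 1 < alpha2 < 2)
  (H1 : alpha2 / 2 + alpha1 * Rmax (3 / 2) (d - 1) <= 1)
  (H2 : lambda * E < 1)
  (H3 : lambda * alpha1 + 4 / 3 * lambda * (1 + 2 * E * d / (1 - lambda * E) + 1 / 2 * alpha2) <= 1)
  (H4 : 4 * kappa * (1 + alpha2) <= lambda * alpha1 /\ lambda * alpha1 <= 1 / 2)
  (H5 : kappa * (alpha2 - 1) / 2 <= 1) :
  forall t, 0 <= t ->
    phi n w x p u s0 sstar kappa lambda alpha1 alpha2 (t + 1)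
      <= (1 - kappa * (alpha2 - 1) / 4) * phi n w x p u s0 sstar kappa lambda alpha1 alpha2 t
    /\
    ((forall r, t <= r <= t + 1 ->
        phi n w x p u s0 sstar kappa lambda alpha1 alpha2 r
          >= 2 * (1 + 2 * alpha2) *
             rsum n (fun i => Rabs (tw w x p s0 sstar kappa i r - w i) * p i r)) ->
     phi n w x p u s0 sstar kappa lambda alpha1 alpha2 (t + 1)
       <= (1 - lambda * alpha1 / (8 * (1 + alpha2))) * phi n w x p u s0 sstar kappa lambda alpha1 alpha2 t).
Proof.
  intros t Ht. split.
  - eapply potential_decay; eassumption.
  - intros Hfar. eapply potential_fast_decay; try eassumption.
    intros r Hr. apply Rge_le, Hfar, Hr.
Qed.
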